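(* Let $\alpha$, $\theta$ be nonconstant inner functions such that $\alpha$ divides $\theta$, let $\varphi\in L^2$ and let $A_\varphi^{\theta,\alpha}\in\mathcal{T}(\theta,\alpha)$. Then there are functions $\psi\in K^2_\alpha$ and $\chi\in K^2_\theta$ such that $A_\varphi^{\theta,\alpha}=A_{\psi+\bar\chi}^{\theta,\alpha}$. Moreover, for $\psi_1\in K^2_\alpha$ and $\chi_1\in K^2_\theta$, one has $A_{\psi+\bar\chi}^{\theta,\alpha}=A_{\psi_1+\bar\chi_1}^{\theta,\alpha}$ if and only if $\psi_1=\psi+c\, k_0^\alpha$ and $\chi_1=\chi -\bar c\,k_0^\theta$ for some constant $c\in\mathbb C$.
   Context: $L^2=L^2(\mathbb T,m)$ with $\mathbb T$ the unit circle and $m$ normalized Lebesgue measure; $H^2\subset L^2$ is the Hardy space of the unit disc. For an inner function $u$, $K^2_u=H^2\ominus uH^2$, $P_u\colon L^2\to K^2_u$ is the orthogonal projection, and $k_0^u=1-\overline{u(0)}\,u\in K_u^2$. $\alpha$ divides $\theta$ means that $\theta/\alpha=\bar\alpha\theta$ is inner. For $\varphi\in L^2$, $A_\varphi^{\theta,\alpha}f=P_\alpha(\varphi f)$ with domain $\{f\in K^2_\theta:\varphi f\in L^2\}$, which contains the dense subspace $K^2_\theta\cap H^\infty$; if it is bounded, $A_\varphi^{\theta,\alpha}$ also denotes its unique bounded extension $K^2_\theta\to K^2_\alpha$. $\mathcal T(\theta,\alpha)$ is the space of all bounded operators $K^2_\theta\to K^2_\alpha$ so obtained with $\varphi\in L^2$.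 *)

(* Defs.v *)
From HB Require Import structures.
From mathcomp Require Import all_boot all_order all_algebra.
From mathcomp Require Import complex.
From mathcomp Require Import all_classical all_reals all_analysis.
From mathcomp Require Import measurable_realfun.

Set Implicit Arguments.
Unset Strict Implicit.
Unset Printing Implicit Defensive.
Import Order.TTheory GRing.Theory Num.Theory.
Import numFieldNormedType.Exports.
Local Open Scope classical_set_scope.
Local Open Scope complex_scope.
Local Open Scope ring_scope.

Definition circle (R : realType) : Type := {z : R[i] | `|z| == 1}.

Section circle.
Variable R : realType.

HB.instance Definition _ :=
  Choice.copy (circle R) {z : R[i] | `|z| == 1}.

Lemma norm_cis (t : R) : `|cos t +i* sin t| == 1.
Proof. by rewrite normc_def /= cos2Dsin2 sqrtr1. Qed.

Definition cis (t : measurableTypeR R) : circle R :=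
  exist _ (cos t +i* sin t) (norm_cis t).

HB.instance Definition _ := isPointed.Build (circle R) (cis 0).

Definition coords (z : circle R) : R * R := (complex.Re (val z), complex.Im (val z)).

(* The Borel sigma-algebra inherited from the plane *)
HB.instance Definition _ :=
  Measurable.copy (circle R) (g_sigma_algebra_preimageType coords).

Lemma measurable_cis : measurable_fun setT cis.
Proof.
move=> _ _ [B mB <-]; rewrite setTI setTI -comp_preimage.
rewrite -[X in measurable X]setTI.
by apply: measurable_fun_pair => //; apply: continuous_measurable_fun;
  [exact: continuous_cos | exact: continuous_sin].
Qed.

HB.instance Definition _ := isMeasurableFun.Build _ _ _ _ cis measurable_cis.

Lemma twopi_gt0 : 0 < 2 * pi :> R.
Proof. by rewrite mulr_gt0 // pi_gt0. Qed.

(* The image of dt / 2pi on [0, 2pi] under t |-> e^{it} *)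
Definition circle_measure : probability (circle R) R :=
  distribution (uniform_prob twopi_gt0) cis.

End circle.

Section hardy.
Variable R : realType.
Local Notation C := R[i].
Local Notation T := (circle R).
Local Notation m := (circle_measure R).
Implicit Types f g h u : T -> C.

(* Elements of L^2 are represented by functions; equality in L^2 is
   the library relation f = g %[ae circle_measure R] *)
Definition L2 : set (T -> C) := [set f : T -> C |
  [/\ measurable_fun setT (fun z => complex.Re (f z)),
      measurable_fun setT (fun z => complex.Im (f z)) &
      m.-integrable setT (fun z => (Normc.normc (f z) ^+ 2)%:E)]].

Definition cintegral f : C :=
  (\int[m]_z complex.Re (f z)) +i* (\int[m]_z complex.Im (f z)).

Definition dotL2 f g : C := cintegral (fun z => f z * (g z)^*).

Definition normL2 f : R := Num.sqrt (\int[m]_z (Normc.normc (f z) ^+ 2)).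

Definition fourier_coef f (n : int) : C :=
  dotL2 f (fun z => (val z) ^ n).

(* H^2 as a subspace of L^2, through boundary values: a function of H^2
   corresponds to the analytic function sum_n (fourier_coef f n) w^n
   on the unit disc *)
Definition H2 : set (T -> C) := [set f : T -> C |
  L2 f /\ forall n : int, n < 0 -> fourier_coef f n = 0].

(* The value at the origin of the analytic extension of f to the disc *)
Definition value0 f : C := fourier_coef f 0.

(* |u| = 1 a.e. makes u bounded, so that u is in H^oo *)
Definition inner_function u : Prop :=
  H2 u /\ {ae m, forall z, `|u z| = 1}.

Definition constant_function u : Prop := exists c : C, u = cst c %[ae m].

Definition inner_divides u v : Prop :=
  inner_function (fun z => (u z)^* * v z).

Definition model_space u : set (T -> C) := [set f : T -> C |
  H2 f /\ forall h, H2 h -> dotL2 f (u \* h) = 0].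

Definition k0 u : T -> C := fun z => 1 - (value0 u)^* * u z.

(* g is the orthogonal projection of f on the subspace K *)
Definition is_orth_proj (K : set (T -> C)) f g : Prop :=
  K g /\ forall k, K k -> dotL2 (f \- g) k = 0.

(* Bounded linear operators, at the level of representatives *)
Definition bounded_operator (K K' : set (T -> C)) (B : (T -> C) -> (T -> C)) :=
  [/\ forall f, K f -> K' (B f),
      forall f g, K f -> K g -> f = g %[ae m] -> B f = B g %[ae m],
      forall (a : C) f g, K f -> K g ->
        B (fun z => a * f z + g z) = (fun z => a * B f z + B g z) %[ae m] &
      exists M : R, forall f, K f -> normL2 (B f) <= M * normL2 f].

(* A_phi^{theta,alpha} is bounded and B is its bounded extension to the whole
   of K^2_theta; by density of the domain, B is then unique up to a.e.
   equality *)
Definition is_ATTO (theta alpha phi : T -> C) (B : (T -> C) -> (T -> C)) :=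
  bounded_operator (model_space theta) (model_space alpha) B /\
  forall f, model_space theta f -> L2 (phi \* f) ->
    is_orth_proj (model_space alpha) (phi \* f) (B f).

(* A_phi belongs to T(theta, alpha) *)
Definition in_ATTO (theta alpha phi : T -> C) : Prop :=
  exists B, is_ATTO theta alpha phi B.

(* A_phi1 and A_phi2 are the same element of T(theta, alpha) *)
Definition same_ATTO (theta alpha phi1 phi2 : T -> C) : Prop :=
  exists B, is_ATTO theta alpha phi1 B /\ is_ATTO theta alpha phi2 B.

Definition symbol (psi chi : T -> C) : T -> C :=
  fun z => psi z + (chi z)^*.

End hardy.

(* Main.v *)
Require Import Defs.
From mathcomp Require Import all_boot all_order all_algebra.
From mathcomp Require Import complex.
From mathcomp Require Import all_classical all_reals all_analysis.
From mathcomp Require Import measurable_realfun.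
From mathcomp Require Import ring lra.
Import Order.TTheory GRing.Theory Num.Theory.
Import numFieldNormedType.Exports.
Local Open Scope classical_set_scope.
Local Open Scope complex_scope.
Local Open Scope ring_scope.
Set Implicit Arguments.
Unset Strict Implicit.
Unset Printing Implicit Defensive.

(** Write K_u for the model space of an inner function u, f(0) for [value0 f],
    and call the form of a symbol w the integral of w f conj(k), for f in
    K_theta and k in K_alpha; it is <A_w f, k> when w f is square integrable.

    Existence. The Riesz projection of L^2 on H^2 gives phi = p + conj(q) with
    p and q in H^2. Since K_u is the complement of u H^2 in H^2, one can write
    p = psi + alpha h1 and q = chi + theta h2 with psi in K_alpha and chi in
    K_theta. For bounded f and k the functions f h1 and k h2 are in H^2, so
    that <alpha f h1, k> = 0 and <f, theta k h2> = 0: the symbols phi and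
    psi + conj(chi) have the same form on bounded functions. Bounded functions
    are dense in K_theta and K_alpha ([bounded_dense]), and by continuity the
    bounded operator of phi is also that of psi + conj(chi)
    ([is_ATTO_of_bounded_form]).

    Uniqueness. Let w = psi + conj(chi), with psi in K_alpha and chi in
    K_theta, be a symbol of the zero operator. The backward shift
    f |-> conj(z) (f - f(0)) preserves model spaces and boundedness, and
    comparing the form of w at (f, k) and at the shifted pair yields
      conj(k(0)) <f, chi> + f(0) <psi, k> = 0
    for bounded f and arbitrary k ([shift_identity]). With f = k0 theta, for
    which f(0) is nonzero because theta is not constant, this says that
    <psi, k> = c conj(k(0)) for some c, and c conj(k(0)) = <c k0 alpha, k>
    because k0 alpha is the reproducing kernel at 0; so psi = c k0 alpha. With
    k = k0 alpha it then says that <f, chi> = - c f(0), and density of bounded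
    functions gives chi = - conj(c) k0 theta. Conversely, k0 alpha and
    conj(k0 theta) are symbols of the same operator ([ATTO_k0_form]).

    Two facts of analysis carry this. L^2 is complete ([L2_complete]), which
    gives the Riesz projection as the sum of a Fourier series. A function in
    L^2 whose Fourier coefficients all vanish is zero ([fourier_coef_inj0]),
    so that the Taylor sums of a function of H^2 converge to it in norm; this
    gives the density of bounded functions and the calculus of products in
    H^2. *)

(** * Complex integration on the circle *)

Section complex_integration.
Variable R : realType.
Local Notation C := R[i].
Local Notation T := (circle R).
Local Notation m := (circle_measure R).
Implicit Types (f g h : T -> C) (x y : C) (u v : T -> R).

Definition rintegrable (u : T -> R) := m.-integrable setT (fun z => (u z)%:E).
Definition cmeasurable f :=
  measurable_fun setT (fun z => complex.Re (f z)) /\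
  measurable_fun setT (fun z => complex.Im (f z)).
Definition cintegrable f :=
  rintegrable (fun z => complex.Re (f z)) /\
  rintegrable (fun z => complex.Im (f z)).

Lemma Re_add x y : complex.Re (x + y) = complex.Re x + complex.Re y.
Proof. by case: x y => [? ?] [? ?]. Qed.
Lemma Im_add x y : complex.Im (x + y) = complex.Im x + complex.Im y.
Proof. by case: x y => [? ?] [? ?]. Qed.
Lemma Re_opp x : complex.Re (- x) = - complex.Re x.
Proof. by case: x => [? ?]. Qed.
Lemma Im_opp x : complex.Im (- x) = - complex.Im x.
Proof. by case: x => [? ?]. Qed.
Lemma Re_mul x y : complex.Re (x * y) =
  complex.Re x * complex.Re y - complex.Im x * complex.Im y.
Proof. by case: x y => [? ?] [? ?]. Qed.
Lemma Im_mul x y : complex.Im (x * y) =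
  complex.Re x * complex.Im y + complex.Im x * complex.Re y.
Proof. by case: x y => [? ?] [? ?]. Qed.
Lemma Re_conj x : complex.Re (x^*) = complex.Re x.
Proof. by case: x => [? ?]. Qed.
Lemma Im_conj x : complex.Im (x^*) = - complex.Im x.
Proof. by case: x => [? ?]. Qed.
Lemma complexP x y :
  complex.Re x = complex.Re y -> complex.Im x = complex.Im y -> x = y.
Proof. by case: x y => [? ?] [? ?] /= -> ->. Qed.

Lemma normc_sqrE x :
  Normc.normc x ^+ 2 = complex.Re x ^+ 2 + complex.Im x ^+ 2.
Proof. by case: x => a b /=; rewrite sqr_sqrtr // addr_ge0 ?sqr_ge0. Qed.

Lemma normcE x : `|x| = (Normc.normc x)%:C.
Proof. by []. Qed.

Lemma mul_conjc x : x * x^* = (Normc.normc x ^+ 2)%:C.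
Proof. by rewrite -normCK normcE rmorphXn. Qed.

Lemma rintegrableD u v : rintegrable u -> rintegrable v ->
  rintegrable (fun z => u z + v z).
Proof. by move=> iu iv; exact: (integrableD measurableT iu iv). Qed.

Lemma rintegrableN u : rintegrable u -> rintegrable (fun z => - u z).
Proof. by move=> iu; exact: (integrableN iu). Qed.

Lemma rintegrableB u v : rintegrable u -> rintegrable v ->
  rintegrable (fun z => u z - v z).
Proof. by move=> iu iv; apply: rintegrableD => //; apply: rintegrableN. Qed.

Lemma rintegrableZ (a : R) u : rintegrable u -> rintegrable (fun z => a * u z).
Proof. by move=> iu; exact: (integrableZl measurableT a iu). Qed.

Lemma rintegrable_measurable u : rintegrable u -> measurable_fun setT u.
Proof. by move=> /measurable_int /measurable_EFinP. Qed.

Lemma rintegrable_le u v : measurable_fun setT u ->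
  (forall z, `|u z| <= v z) -> rintegrable v -> rintegrable u.
Proof.
move=> mu uv; apply: le_integrable => //; first exact/measurable_EFinP.
move=> z _ /=; rewrite lee_fin; apply: le_trans (uv z) _; exact: ler_norm.
Qed.

Lemma rintegrable_cst (a : R) : rintegrable (cst a).
Proof. exact: finite_measure_integrable_cst. Qed.

Lemma rintegrable_bounded u M : measurable_fun setT u ->
  (forall z, `|u z| <= M) -> rintegrable u.
Proof. by move=> mu uM; apply: (rintegrable_le mu uM (rintegrable_cst M)). Qed.

Lemma Rintegral_ae_eq (u v : T -> R) :
  measurable_fun setT u -> measurable_fun setT v ->
  {ae m, forall z, u z = v z} -> \int[m]_z u z = \int[m]_z v z.
Proof.
move=> mu mv uv; congr fine; apply: ae_eq_integral => //.
- exact/measurable_EFinP.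
- exact/measurable_EFinP.
- by apply: filterS uv => z ->.
Qed.

Lemma Rintegral_nonneg_eq0 u : rintegrable u -> (forall z, 0 <= u z) ->
  \int[m]_z u z = 0 -> {ae m, forall z, u z = 0}.
Proof.
move=> iu u0 /eqP; rewrite /Rintegral => /eqP e0.
have fin := integrable_fin_num measurableT iu.
have e1 : (\int[m]_z `|(u z)%:E| = 0)%E.
  rewrite (eq_integral (fun z => (u z)%:E)); last first.
    by move=> z _; rewrite /= ger0_norm.
  by rewrite -(fineK fin) e0.
have mu : measurable_fun setT (fun z => (u z)%:E) by apply: measurable_int iu.
have /(_ e1) := (ae_eq_integral_abs m measurableT mu).1.
by apply: filterS => z /(_ I) [].
Qed.

Lemma cmeasurableD f g : cmeasurable f -> cmeasurable g ->
  cmeasurable (fun z => f z + g z).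
Proof.
move=> [? ?] [? ?]; split.
- by under eq_fun do rewrite Re_add; apply: measurable_funD.
- by under eq_fun do rewrite Im_add; apply: measurable_funD.
Qed.

Lemma cmeasurableN f : cmeasurable f -> cmeasurable (fun z => - f z).
Proof.
move=> [? ?]; split.
- by under eq_fun do rewrite Re_opp; apply: measurableT_comp.
- by under eq_fun do rewrite Im_opp; apply: measurableT_comp.
Qed.

Lemma cmeasurableM f g : cmeasurable f -> cmeasurable g ->
  cmeasurable (fun z => f z * g z).
Proof.
move=> [? ?] [? ?]; split.
- by under eq_fun do rewrite Re_mul;
    apply: measurable_funB; apply: measurable_funM.
- by under eq_fun do rewrite Im_mul;
    apply: measurable_funD; apply: measurable_funM.
Qed.

Lemma cmeasurableJ f : cmeasurable f -> cmeasurable (fun z => (f z)^*).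
Proof.
move=> [? ?]; split.
- by under eq_fun do rewrite Re_conj.
- by under eq_fun do rewrite Im_conj; apply: measurableT_comp.
Qed.

Lemma cmeasurable_cst (a : C) : cmeasurable (fun=> a).
Proof. by split; apply: measurable_cst. Qed.

Lemma cmeasurable_sqr f : cmeasurable f ->
  measurable_fun setT (fun z => Normc.normc (f z) ^+ 2).
Proof.
move=> [? ?]; under eq_fun do rewrite normc_sqrE.
by apply: measurable_funD; apply: measurable_funX.
Qed.

Lemma cintegrable_measurable f : cintegrable f -> cmeasurable f.
Proof. by move=> [? ?]; split; apply: rintegrable_measurable. Qed.

Lemma cintegrableD f g : cintegrable f -> cintegrable g ->
  cintegrable (fun z => f z + g z).
Proof.
move=> [? ?] [? ?]; split; rewrite /rintegrable.
- by under eq_fun do rewrite Re_add; apply: rintegrableD.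
- by under eq_fun do rewrite Im_add; apply: rintegrableD.
Qed.

Lemma cintegrableZ (a : C) f : cintegrable f -> cintegrable (fun z => a * f z).
Proof.
move=> [? ?]; split; rewrite /rintegrable.
- by under eq_fun do rewrite Re_mul; apply: rintegrableB; apply: rintegrableZ.
- by under eq_fun do rewrite Im_mul; apply: rintegrableD; apply: rintegrableZ.
Qed.

Lemma cintegrable_le f u : cmeasurable f ->
  (forall z, `|complex.Re (f z)| <= u z) ->
  (forall z, `|complex.Im (f z)| <= u z) -> rintegrable u -> cintegrable f.
Proof. by move=> [? ?] ? ? iu; split; apply: rintegrable_le iu. Qed.

Lemma cintegralD f g : cintegrable f -> cintegrable g ->
  cintegral (fun z => f z + g z) = cintegral f + cintegral g.
Proof.
move=> [? ?] [? ?]; apply: complexP; rewrite ?Re_add ?Im_add /=.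
- by under eq_Rintegral do rewrite Re_add; rewrite RintegralD.
- by under eq_Rintegral do rewrite Im_add; rewrite RintegralD.
Qed.

Lemma cintegralZ (a : C) f : cintegrable f ->
  cintegral (fun z => a * f z) = a * cintegral f.
Proof.
move=> [? ?]; apply: complexP; rewrite ?Re_mul ?Im_mul /=.
- under eq_Rintegral do rewrite Re_mul.
  by rewrite RintegralB ?RintegralZl //; apply: rintegrableZ.
- under eq_Rintegral do rewrite Im_mul.
  by rewrite RintegralD ?RintegralZl //; apply: rintegrableZ.
Qed.

Lemma cintegralJ f : cintegrable f ->
  cintegral (fun z => (f z)^*) = (cintegral f)^*.
Proof.
move=> [? ?]; apply: complexP; rewrite ?Re_conj ?Im_conj /=.
- by under eq_Rintegral do rewrite Re_conj.
- under eq_Rintegral do rewrite Im_conj -mulN1r.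
  by rewrite RintegralZl // mulN1r.
Qed.

Lemma cintegral_ae_eq f g : cmeasurable f -> cmeasurable g ->
  {ae m, forall z, f z = g z} -> cintegral f = cintegral g.
Proof.
move=> [? ?] [? ?] fg; apply: complexP => /=; apply: Rintegral_ae_eq => //;
  by apply: filterS fg => z ->.
Qed.

Lemma cintegral_cst (a : C) : cintegral (fun=> a) = a.
Proof.
apply: complexP => /=; rewrite Rintegral_cst //=;
  by rewrite probability_setT mulr1.
Qed.

End complex_integration.

(** * The inner product of L^2 *)

Section L2_space.
Variable R : realType.
Local Notation C := R[i].
Local Notation T := (circle R).
Local Notation m := (circle_measure R).
Implicit Types (f g h : T -> C) (x y : C) (u v : T -> R).

Definition ae_bounded f :=
  cmeasurable f /\ exists M : R, {ae m, forall z, Normc.normc (f z) <= M}.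

Lemma normc_ge0 x : 0 <= Normc.normc x.
Proof. by case: x => a b /=; exact: sqrtr_ge0. Qed.

Lemma rintegrable_ae_le u v : measurable_fun setT u ->
  {ae m, forall z, `|u z| <= v z} -> rintegrable v -> rintegrable u.
Proof.
move=> mu uv iv; apply/integrableP; split; first exact/measurable_EFinP.
have mv := rintegrable_measurable iv.
have /integrableP[_] := iv; apply: le_lt_trans.
apply: ae_ge0_le_integral => //.
- by apply/measurable_EFinP/measurableT_comp.
- by apply/measurable_EFinP/measurableT_comp.
apply: filterS uv => z uvz _ /=; rewrite lee_fin.
by apply: le_trans uvz _; exact: ler_norm.
Qed.

Lemma L2P f : L2 f <->
  cmeasurable f /\ rintegrable (fun z => Normc.normc (f z) ^+ 2).
Proof. by split => [[? ?] ?|[[? ?] ?]]. Qed.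

Lemma L2_cmeasurable f : L2 f -> cmeasurable f.
Proof. by case/L2P. Qed.

Lemma L2_sqr f : L2 f -> rintegrable (fun z => Normc.normc (f z) ^+ 2).
Proof. by case/L2P. Qed.

Lemma L2D f g : L2 f -> L2 g -> L2 (fun z => f z + g z).
Proof.
move=> /L2P[mf f2] /L2P[mg g2]; have mfg := cmeasurableD mf mg; apply/L2P.
split=> //; apply: (rintegrable_le (v := fun z =>
  2 * Normc.normc (f z) ^+ 2 + 2 * Normc.normc (g z) ^+ 2)).
- exact: (cmeasurable_sqr mfg).
- move=> z; rewrite !normc_sqrE ger0_norm ?addr_ge0 ?sqr_ge0 // Re_add Im_add.
  move: (complex.Re _) (complex.Im _) (complex.Re _) (complex.Im _) => a b c e.
  by have := sqr_ge0 (a - c); have := sqr_ge0 (b - e); nra.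
- by apply: rintegrableD; apply: rintegrableZ.
Qed.

Lemma ae_boundedM f g : ae_bounded f -> ae_bounded g ->
  ae_bounded (fun z => f z * g z).
Proof.
move=> [mf [M fM]] [mg [N gN]]; split; first exact: cmeasurableM.
exists (M * N); apply: filterS2 fM gN => z fM gN.
by rewrite Normc.normcM ler_pM ?normc_ge0.
Qed.

Lemma ae_boundedD f g : ae_bounded f -> ae_bounded g ->
  ae_bounded (fun z => f z + g z).
Proof.
move=> [mf [M fM]] [mg [N gN]]; split; first exact: cmeasurableD.
exists (M + N); apply: filterS2 fM gN => z fM gN.
by apply: le_trans (le_normcD _ _) _; exact: lerD.
Qed.

Lemma ae_boundedN f : ae_bounded f -> ae_bounded (fun z => - f z).
Proof.
move=> [mf [M fM]]; split; first exact: cmeasurableN.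
by exists M; apply: filterS fM => z; rewrite normcN.
Qed.

Lemma ae_boundedB f g : ae_bounded f -> ae_bounded g ->
  ae_bounded (fun z => f z - g z).
Proof. by move=> bf bg; apply: ae_boundedD => //; exact: ae_boundedN. Qed.

Lemma normcJ x : Normc.normc (x^*) = Normc.normc x.
Proof. by case: x => a b /=; rewrite sqrrN. Qed.

Lemma ae_boundedJ f : ae_bounded f -> ae_bounded (fun z => (f z)^*).
Proof.
move=> [mf [M fM]]; split; first exact: cmeasurableJ.
by exists M; apply: filterS fM => z; rewrite normcJ.
Qed.

Lemma ae_bounded_cst x : ae_bounded (fun=> x).
Proof.
by split; [exact: cmeasurable_cst | exists (Normc.normc x); exact: aeW].
Qed.

Lemma L2M f g : ae_bounded f -> L2 g -> L2 (fun z => f z * g z).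
Proof.
move=> [mf [M fM]] /L2P[mg g2]; have mfg := cmeasurableM mf mg; apply/L2P.
split=> //; apply: (rintegrable_ae_le (v := fun z =>
  M ^+ 2 * Normc.normc (g z) ^+ 2)).
- exact: (cmeasurable_sqr mfg).
- apply: filterS fM => z fM; rewrite ger0_norm ?sqr_ge0 // Normc.normcM exprMn.
  by rewrite ler_wpM2r ?sqr_ge0 // lerXn2r ?nnegrE ?normc_ge0 //;
    apply: le_trans fM; exact: normc_ge0.
- exact: rintegrableZ.
Qed.

Lemma L2_cst x : L2 (fun=> x).
Proof.
apply/L2P; split; first exact: cmeasurable_cst.
exact: (rintegrable_cst (Normc.normc x ^+ 2)).
Qed.

Lemma ae_bounded_L2 f : ae_bounded f -> L2 f.
Proof.
move=> /L2M /(_ (L2_cst 1)).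
by under eq_fun do rewrite mulr1.
Qed.

Lemma L2Z x f : L2 f -> L2 (fun z => x * f z).
Proof. exact/L2M/ae_bounded_cst. Qed.

Lemma L2N f : L2 f -> L2 (fun z => - f z).
Proof. by move=> /(L2Z (-1)); under eq_fun do rewrite mulN1r. Qed.

Lemma L2B f g : L2 f -> L2 g -> L2 (fun z => f z - g z).
Proof. by move=> Lf Lg; apply: L2D => //; exact: L2N. Qed.

Lemma L2J f : L2 f -> L2 (fun z => (f z)^*).
Proof.
move=> /L2P[mf f2]; apply/L2P; split; first exact: cmeasurableJ.
by rewrite /rintegrable; under eq_fun do rewrite normcJ.
Qed.

Lemma cintegrableM f g : L2 f -> L2 g -> cintegrable (fun z => f z * g z).
Proof.
move=> /L2P[mf f2] /L2P[mg g2]; apply: (cintegrable_le (u := fun z =>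
  Normc.normc (f z) ^+ 2 + Normc.normc (g z) ^+ 2)).
- exact: cmeasurableM.
- move=> z; rewrite !normc_sqrE Re_mul ler_norml.
  move: (complex.Re _) (complex.Re _) (complex.Im _) (complex.Im _) => a b c e.
  apply/andP; split.
    have : 0 <= (a + b) ^+ 2 + (c - e) ^+ 2 by rewrite addr_ge0 ?sqr_ge0.
    by nra.
  have : 0 <= (a - b) ^+ 2 + (c + e) ^+ 2 by rewrite addr_ge0 ?sqr_ge0.
  by nra.
- move=> z; rewrite !normc_sqrE Im_mul ler_norml.
  move: (complex.Re _) (complex.Im _) (complex.Im _) (complex.Re _) => a b c e.
  apply/andP; split.
    have : 0 <= (e + b) ^+ 2 + (c + a) ^+ 2 by rewrite addr_ge0 ?sqr_ge0.
    by nra.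
  have : 0 <= (e - b) ^+ 2 + (c - a) ^+ 2 by rewrite addr_ge0 ?sqr_ge0.
  by nra.
- exact: rintegrableD.
Qed.

Lemma L2_cintegrable f : L2 f -> cintegrable f.
Proof.
move=> Lf; have := cintegrableM Lf (L2_cst 1).
by under eq_fun do rewrite mulr1.
Qed.

Lemma cintegrable_dot f g : L2 f -> L2 g -> cintegrable (fun z => f z * (g z)^*).
Proof. by move=> Lf Lg; apply: cintegrableM => //; exact: L2J. Qed.

Lemma dotL2Dl f g h : L2 f -> L2 g -> L2 h ->
  dotL2 (fun z => f z + g z) h = dotL2 f h + dotL2 g h.
Proof.
move=> Lf Lg Lh; rewrite /dotL2 -cintegralD; [|exact: cintegrable_dot..].
by congr cintegral; apply/funext => z; rewrite mulrDl.
Qed.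

Lemma dotL2Zl x f h : L2 f -> L2 h ->
  dotL2 (fun z => x * f z) h = x * dotL2 f h.
Proof.
move=> Lf Lh; rewrite /dotL2 -cintegralZ; last exact: cintegrable_dot.
by congr cintegral; apply/funext => z; rewrite mulrA.
Qed.

Lemma dotL2Nl f h : L2 f -> L2 h ->
  dotL2 (fun z => - f z) h = - dotL2 f h.
Proof.
move=> Lf Lh; rewrite -mulN1r -dotL2Zl //.
have -> // : (fun z => - f z) = (fun z => -1 * f z).
by apply/funext => z; rewrite mulN1r.
Qed.

Lemma dotL2Bl f g h : L2 f -> L2 g -> L2 h ->
  dotL2 (fun z => f z - g z) h = dotL2 f h - dotL2 g h.
Proof. by move=> Lf Lg Lh; rewrite dotL2Dl ?dotL2Nl //; exact: L2N. Qed.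

Lemma dotL2J f g : L2 f -> L2 g -> dotL2 g f = (dotL2 f g)^*.
Proof.
move=> Lf Lg; rewrite /dotL2 -cintegralJ; last exact: cintegrable_dot.
by congr cintegral; apply/funext => z; rewrite rmorphM /= conjCK mulrC.
Qed.

Lemma dotL2Dr f g h : L2 f -> L2 g -> L2 h ->
  dotL2 h (fun z => f z + g z) = dotL2 h f + dotL2 h g.
Proof.
move=> Lf Lg Lh; rewrite dotL2J ?dotL2Dl //; last exact: L2D.
by rewrite rmorphD /= -!dotL2J.
Qed.

Lemma dotL2Zr x f h : L2 f -> L2 h ->
  dotL2 h (fun z => x * f z) = x^* * dotL2 h f.
Proof.
move=> Lf Lh; rewrite dotL2J ?dotL2Zl //; last exact: L2Z.
by rewrite rmorphM /= -!dotL2J.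
Qed.

Lemma dotL2Nr f h : L2 f -> L2 h -> dotL2 h (fun z => - f z) = - dotL2 h f.
Proof.
move=> Lf Lh; rewrite dotL2J ?dotL2Nl //; last exact: L2N.
by rewrite rmorphN /= -!dotL2J.
Qed.

Lemma dotL2Br f g h : L2 f -> L2 g -> L2 h ->
  dotL2 h (fun z => f z - g z) = dotL2 h f - dotL2 h g.
Proof. by move=> Lf Lg Lh; rewrite dotL2Dr ?dotL2Nr //; exact: L2N. Qed.

Lemma dotL2_ae_eq f f' g g' : L2 f -> L2 f' -> L2 g -> L2 g' ->
  f = f' %[ae m] -> g = g' %[ae m] -> dotL2 f g = dotL2 f' g'.
Proof.
move=> Lf Lf' Lg Lg' ff' gg'; apply: cintegral_ae_eq.
- exact/cintegrable_measurable/cintegrable_dot.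
- exact/cintegrable_measurable/cintegrable_dot.
- by apply: filterS2 ff' gg' => z /(_ I) -> /(_ I) ->.
Qed.

Lemma normL2_ge0 f : 0 <= normL2 f.
Proof. exact: sqrtr_ge0. Qed.

Lemma sqr_normL2 f : normL2 f ^+ 2 = \int[m]_z (Normc.normc (f z) ^+ 2).
Proof. by rewrite sqr_sqrtr // Rintegral_ge0 // => z _; exact: sqr_ge0. Qed.

Lemma dotL2_norm f : dotL2 f f = (normL2 f ^+ 2)%:C.
Proof.
rewrite sqr_normL2; apply: complexP => /=.
- by apply: eq_Rintegral => z _; rewrite mul_conjc.
- under eq_Rintegral do rewrite mul_conjc.
  by rewrite Rintegral_cst //= mul0r.
Qed.

Lemma normL2_eq0 f : L2 f -> normL2 f = 0 -> f = cst 0 %[ae m].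
Proof.
move=> Lf f0; have /Rintegral_nonneg_eq0 := L2_sqr Lf.
move=> /(_ (fun z => sqr_ge0 _)); rewrite -sqr_normL2 f0 expr0n /= => /(_ erefl).
by apply: filterS => z /eqP; rewrite sqrf_eq0 => /eqP /Normc.eq0_normc.
Qed.

Lemma dotL2_eq0 f : L2 f -> dotL2 f f = 0 -> f = cst 0 %[ae m].
Proof.
move=> Lf; rewrite dotL2_norm => -[] /eqP.
by rewrite sqrf_eq0 => /eqP; exact: normL2_eq0.
Qed.

Lemma normL2_ae_eq f g : L2 f -> L2 g -> f = g %[ae m] -> normL2 f = normL2 g.
Proof.
move=> Lf Lg fg; have := dotL2_ae_eq Lf Lg Lf Lg fg fg.
rewrite !dotL2_norm => -[] /eqP.
by rewrite eqrXn2 ?normL2_ge0 // => /eqP.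
Qed.

Lemma conjcR (a : R) : (a%:C)^* = a%:C.
Proof. by apply: complexP; rewrite ?Re_conj ?Im_conj //= oppr0. Qed.

(** Expand |G^2 f - c g|^2 with G the norm of g and c = <f, g>. *)
Lemma cauchy_schwarz f g : L2 f -> L2 g ->
  Normc.normc (dotL2 f g) <= normL2 f * normL2 g.
Proof.
move=> Lf Lg; set F := normL2 f; set G := normL2 g; set c := dotL2 f g.
have F0 : 0 <= F by exact: normL2_ge0.
have : 0 <= G by exact: normL2_ge0.
rewrite le_eqVlt => /predU1P[G0|G0].
  have g0 := normL2_eq0 Lg (esym G0).
  rewrite /c (dotL2_ae_eq Lf Lf Lg (L2_cst 0) (ae_eq_refl _ _ _) g0).
  rewrite /dotL2; under eq_fun do rewrite rmorph0 mulr0.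
  by rewrite cintegral_cst Normc.normc0 -G0 mulr0.
pose h := fun z => (G ^+ 2)%:C * f z - c * g z.
have Lh : L2 h by apply: L2B; apply: L2Z.
have : dotL2 h h = (G ^+ 2 * (F ^+ 2 * G ^+ 2 - Normc.normc c ^+ 2))%:C.
  rewrite /h !(dotL2Bl, dotL2Br, dotL2Zl, dotL2Zr) //;
    try by [apply: L2Z | apply: L2B; apply: L2Z].
  rewrite !dotL2_norm (dotL2J Lf Lg) -/c -/F -/G.
  rewrite conjcR; move: (mul_conjc c).
  move: (G ^+ 2) (F ^+ 2) (Normc.normc c ^+ 2) => g2 f2 n e.
  by rewrite !(rmorphM, rmorphB) /= -e; ring.
rewrite dotL2_norm => -[] e.
have : 0 <= G ^+ 2 * (F ^+ 2 * G ^+ 2 - Normc.normc c ^+ 2).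
  by rewrite -e sqr_ge0.
rewrite pmulr_rge0 ?exprn_gt0 // subr_ge0 -exprMn.
by rewrite ler_pXn2r // nnegrE ?normc_ge0 // mulr_ge0 // ltW.
Qed.

End L2_space.

(** * Completeness of real L^2 *)

Section L2_completeness.
Variables (d : measure_display) (X : measurableType d) (R : realType).
Variable mu : probability X R.
Implicit Types (u v w : X -> R).

(** On a probability space the L^1 norm is bounded by the L^2 norm; the weighted
    inequality 2 e |t| <= e^2 + t^2 gives this for a given bound e without taking
    square roots of integrals. *)
Lemma le_integral_abs_sqr u (e : R) : measurable_fun setT u -> 0 < e ->
  (\int[mu]_x ((u x) ^+ 2)%:E <= (e ^+ 2)%:E)%E ->
  (\int[mu]_x (`|u x|)%:E <= e%:E)%E.
Proof.
move=> mu_ e0 ue.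
have mu2 : measurable_fun setT (fun x => (u x ^+ 2)%:E).
  exact/measurable_EFinP/measurable_funX.
have e20 : 0 <= (2 * e)^-1 by rewrite invr_ge0 mulr_ge0 // ltW.
apply: (@le_trans _ _
    (\int[mu]_x ((e / 2)%:E + ((2 * e)^-1)%:E * (u x ^+ 2)%:E))%E).
  apply: ge0_le_integral => //.
  - exact/measurable_EFinP/measurableT_comp.
  - apply: emeasurable_funD => //; exact: emeasurable_funM.
  - move=> x _; rewrite lee_fin -subr_ge0.
    have -> : e / 2 + (2 * e)^-1 * u x ^+ 2 - `|u x| =
              (2 * e)^-1 * (`|u x| - e) ^+ 2.
      by rewrite -(real_normK (num_real (u x))); field; rewrite gt_eqF.
    by rewrite mulr_ge0 // sqr_ge0.
rewrite ge0_integralD //=.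
- rewrite integral_cst //= probability_setT mule1 ge0_integralZl //; last first.
    by move=> x _; rewrite lee_fin sqr_ge0.
  have -> : e%:E = ((e / 2)%:E + ((2 * e)^-1)%:E * (e ^+ 2)%:E)%E.
    by congr EFin; field; rewrite gt_eqF.
  by rewrite leeD2l // lee_pmul2l // lte_fin invr_gt0 mulr_gt0.
- by move=> x _; rewrite lee_fin divr_ge0 // ltW.
- by move=> x _; rewrite -EFinM lee_fin mulr_ge0 ?sqr_ge0.
- exact: emeasurable_funM.
Qed.

Lemma cvg_of_summable_increments (w : nat -> R) :
  (\sum_(0 <= k <oo) (`|w k.+1 - w k|)%:E < +oo)%E -> cvgn w.
Proof.
move=> Soo.
suff : cvgn (series (telescope w)).
  rewrite telescopeK => /(is_cvgD (is_cvg_cst (w 0%N))).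
  by congr (cvgn _); apply/funext => n /=; rewrite addrC subrK.
apply: normed_cvg; apply: nondecreasing_is_cvgn.
  apply/nondecreasing_seqP => n.
  by rewrite /= (seriesSr (fun k => `|telescope w k|)) lerDl.
set S := (\sum_(0 <= k <oo) _)%E in Soo.
have S0 : (0 <= S)%E by apply: nneseries_ge0 => k _ _; rewrite lee_fin.
have Sfin : S \is a fin_num by rewrite ge0_fin_numE.
exists (fine S) => _ [n _ <-]; rewrite -lee_fin fineK // /series /= -sumEFin.
by apply: nneseries_lim_ge => k _ _; rewrite lee_fin.
Qed.

(** If the increments are bounded by 2^-(k+1) in L^2, hence in L^1, their sum is
    integrable, so that the increments are summable almost everywhere. *)
Lemma L2_fast_cauchy_limit (w : nat -> X -> R) :
  (forall n, measurable_fun setT (w n)) ->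
  (forall k, (\int[mu]_x ((w k.+1 x - w k x) ^+ 2)%:E <=
     ((1 / (2 ^ k.+1)%:R) ^+ 2)%:E)%E) ->
  exists v, measurable_fun setT v /\
    {ae mu, forall x, w n x @[n --> \oo] --> v x}.
Proof.
move=> mw ws.
have mdw k : measurable_fun setT (fun x => (`|w k.+1 x - w k x|)%:E).
  by apply/measurable_EFinP/measurableT_comp => //; exact: measurable_funB.
pose S x : \bar R := (\sum_(0 <= k <oo) (`|w k.+1 x - w k x|)%:E)%E.
have S0 x : (0 <= S x)%E by apply: nneseries_ge0 => k _ _; rewrite lee_fin.
have mS : measurable_fun setT S.
  by apply: ge0_emeasurable_sum => // k x _ _; rewrite lee_fin.
have intS : (\int[mu]_x S x <= 1%:E)%E.
  rewrite integral_nneseries //.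
  apply: le_trans (@epsilon_trick0 R 1 xpredT ler01).
  apply: lee_nneseries => k _ => [_|].
    by apply: integral_ge0 => x _; rewrite lee_fin.
  apply: le_integral_abs_sqr => //; first exact: measurable_funB.
have Sae : {ae mu, forall x, (S x < +oo)%E}.
  have iS : mu.-integrable setT S.
    apply/integrableP; split=> //.
    under eq_integral do rewrite gee0_abs //.
    exact: le_lt_trans intS (ltry _).
  have := integrable_ae measurableT iS.
  by apply: filterS => x /(_ I); rewrite ge0_fin_numE.
pose G := [set x | (S x < +oo)%E].
have mG : measurable G.
  by have := emeasurable_fun_infty_o measurableT mS +oo%E; rewrite setTI.
have cw x : cvgn (fun n => w n x * \1_G x).
  have [Gx|Gx] := pselect (G x).
    rewrite indicE mem_set //; under eq_fun do rewrite mulr1.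
    exact: cvg_of_summable_increments.
  rewrite indicE memNset //; under eq_fun do rewrite mulr0.
  exact: is_cvg_cst.
exists (fun x => limn (fun n => w n x * \1_G x)); split.
  apply: (measurable_fun_cvg (h := fun n x => w n x * \1_G x)) => //.
  move=> n; apply: measurable_funM => //; exact: measurable_indic.
apply: filterS Sae => x Sx; have := cw x.
by rewrite indicE mem_set //; under eq_fun do rewrite mulr1.
Qed.

(** The limit is that of a subsequence with geometrically decreasing increments;
    Fatou's lemma, applied along the subsequence, transfers the Cauchy bound to
    the limit. *)
Lemma L2_complete (u : nat -> X -> R) :
  (forall n, measurable_fun setT (u n)) ->
  (forall e, 0 < e -> exists N, forall i j, (N <= i)%N -> (N <= j)%N ->
     (\int[mu]_x ((u i x - u j x) ^+ 2)%:E <= e%:E)%E) ->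
  exists v, measurable_fun setT v /\
    forall e, 0 < e -> exists N, forall n, (N <= n)%N ->
     (\int[mu]_x ((v x - u n x) ^+ 2)%:E <= e%:E)%E.
Proof.
move=> mu_ cau.
have cauk k : exists N, forall i j, (N <= i)%N -> (N <= j)%N ->
    (\int[mu]_x ((u i x - u j x) ^+ 2)%:E <= ((1 / (2 ^ k.+1)%:R) ^+ 2)%:E)%E.
  by apply: cau; rewrite exprn_gt0 // divr_gt0 // ltr0n expn_gt0.
have [N NP] := choice cauk.
(* n k is at least k, N k and N (k - 1); the last bound applies to increments. *)
pose n k := (k + \sum_(i < k.+1) N i)%N.
have nk k : (k <= n k)%N by rewrite leq_addr.
have Nn k : (N k <= n k)%N.
  by rewrite /n big_ord_recr /= addnA leq_addl.
have Nn1 k : (N k <= n k.+1)%N.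
  by rewrite /n 2!big_ord_recr /= addnAC addnA leq_addl.
have [v [mv wv]] := @L2_fast_cauchy_limit (fun k => u (n k))
  (fun k => mu_ (n k)) (fun k => NP k _ _ (Nn1 k) (Nn k)).
exists v; split => // e e0; have [M MP] := cau e e0.
exists M => j Mj.
have -> : (\int[mu]_x ((v x - u j x) ^+ 2)%:E =
   \int[mu]_x limn_einf (fun k => ((u (n k) x - u j x) ^+ 2)%:E))%E.
  apply: ae_eq_integral => //.
  - by apply/measurable_EFinP/measurable_funX; exact: measurable_funB.
  - under eq_fun do rewrite -[limn_einf _]oppeK -limn_esupN.
    apply: measurableT_comp => //; apply: measurable_fun_limn_esup => k.
    apply: measurableT_comp => //.
    by apply/measurable_EFinP/measurable_funX; exact: measurable_funB.
  - apply: filterS wv => x wvx _; apply/esym.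
    have := @cvg_limn_einf_sup R (fun k => ((u (n k) x - u j x) ^+ 2)%:E)
      (((v x - u j x) ^+ 2)%:E).
    case=> //; apply: cvg_EFin; first by near=> k.
    by rewrite /comp /=; under eq_fun do rewrite expr2; rewrite expr2;
      apply: cvgM; apply: cvgB => //; exact: cvg_cst.
apply: le_trans.
  apply: fatou => //; last by move=> k x _; rewrite lee_fin sqr_ge0.
  by move=> k; apply/measurable_EFinP/measurable_funX; exact: measurable_funB.
rewrite limn_einf_lim; apply: lime_le; first exact: is_cvg_einfs.
near=> k; apply: le_trans.
  apply: ereal_inf_lbound; exists k => //=.
apply: MP => //; apply: leq_trans (nk k); near: k; exact: nbhs_infty_ge.
Unshelve. all: by end_near. Qed.

End L2_completeness.

(** * The characters of the circle *)

Section characters.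
Variable R : realType.
Local Notation C := R[i].
Local Notation T := (circle R).
Local Notation m := (circle_measure R).
Implicit Types (f g h : T -> C) (x y : C) (u v : T -> R) (n : int).

Definition zpow (n : int) : T -> C := fun z => val z ^ n.
Arguments zpow : simpl never.

Lemma norm_val (z : T) : `|val z| = 1.
Proof. by case: z => z /= /eqP. Qed.

Lemma val_neq0 (z : T) : val z != 0.
Proof. by rewrite -normr_eq0 norm_val oner_neq0. Qed.

Lemma val_unit (z : T) : val z \is a GRing.unit.
Proof. by rewrite unitfE val_neq0. Qed.

Lemma conj_val (z : T) : (val z)^* = (val z)^-1.
Proof. by rewrite invC_norm norm_val expr1n invr1 mul1r. Qed.

Lemma zpowJ n (z : T) : (zpow n z)^* = zpow (- n) z.
Proof. by rewrite /zpow rmorphXz ?val_unit //= conj_val exprz_inv. Qed.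

Lemma zpowD n p (z : T) : zpow (n + p) z = zpow n z * zpow p z.
Proof. by rewrite /zpow expfzDr ?val_neq0. Qed.

Lemma zpow0 (z : T) : zpow 0 z = 1.
Proof. by rewrite /zpow expr0z. Qed.

Lemma normc_zpow n (z : T) : Normc.normc (zpow n z) = 1.
Proof.
have := mul_conjc (zpow n z); rewrite zpowJ -zpowD subrr zpow0 => -[] /esym/eqP.
by rewrite sqrp_eq1 ?normc_ge0 // => /eqP.
Qed.

Lemma measurable_coords : measurable_fun setT (@coords R).
Proof. by move=> _ B mB; exists B. Qed.

Lemma cmeasurable_val : cmeasurable (fun z : T => val z).
Proof.
split.
- exact: (measurableT_comp measurable_fst measurable_coords).
- exact: (measurableT_comp measurable_snd measurable_coords).
Qed.

Lemma cmeasurable_zpow n : cmeasurable (zpow n).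
Proof.
suff nat_case k : cmeasurable (zpow k%:Z).
  case: n => n //; have := cmeasurableJ (nat_case n.+1).
  by under eq_fun do rewrite zpowJ -NegzE.
elim: k => [|k IH].
  rewrite (_ : zpow 0 = fun=> 1); first exact: cmeasurable_cst.
  by apply/funext => z; rewrite zpow0.
rewrite (_ : zpow k.+1 = fun z => zpow k z * val z); last first.
  by apply/funext => z; rewrite -addn1 PoszD zpowD.
exact: cmeasurableM IH cmeasurable_val.
Qed.

Lemma ae_bounded_zpow n : ae_bounded (zpow n).
Proof.
split; first exact: cmeasurable_zpow.
by exists 1; apply: aeW => z; rewrite normc_zpow.
Qed.

Lemma L2_zpow n : L2 (zpow n).
Proof. exact/ae_bounded_L2/ae_bounded_zpow. Qed.

(** Adding 1 makes the integrand nonnegative, so that its integral can be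
    transported to [0, 2 pi]; there it is computed from the primitive t + F t. *)
Lemma circle_mean_eq0 (u : T -> R) (g F : R -> R) :
  measurable_fun setT u -> (forall z, `|u z| <= 1) ->
  (forall t, u (cis t) = g t) -> continuous g ->
  (forall t : R, is_derive t (1 : R) F (g t)) ->
  F (2 * pi) = F 0 -> \int[m]_z u z = 0.
Proof.
move=> mu u1 ug cg Fg F2pi.
have u0 z : 0 <= 1 + u z by have := u1 z; rewrite ler_norml; lra.
have iu : rintegrable u by exact: rintegrable_bounded u1.
have mu1 : measurable_fun setT (fun z => (1 + u z)%:E).
  by apply/measurable_EFinP/measurable_funD.
have cg1 : continuous (fun t => 1 + g t).
  by move=> t; apply: cvgD; [exact: cvg_cst | exact: cg].
suff : \int[m]_z (1 + u z) = 1.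
  rewrite RintegralD //; last exact: rintegrable_cst.
  by rewrite Rintegral_cst //= probability_setT mulr1; lra.
have dF (t : R) : is_derive t (1 : R) (fun t => t + F t) (1 + g t).
  by apply: is_deriveD.
have cF (t : R) : {for t, continuous (fun t => t + F t)}.
  by apply/differentiable_continuous/derivable1_diffP; have [] := dF t.
rewrite /Rintegral ge0_integral_distribution //.
under eq_integral do rewrite /comp /= ug.
have mg1 : measurable_fun setT (fun t => (1 + g t)%:E).
  by apply/measurable_EFinP; exact: continuous_measurable_fun.
rewrite integral_uniform //; last first.
  by move=> t; rewrite lee_fin -ug.
rewrite (@continuous_FTC2 _ _ (fun t => t + F t)) ?twopi_gt0 //.
- by rewrite F2pi subr0 -EFinB -EFinM /= add0r addrK mulVf // gt_eqF // twopi_gt0.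
- exact: continuous_subspaceT.
- split.
  + by move=> t _; have [] := dF t.
  + by apply: cvg_at_right_filter; exact: cF.
  + by apply: cvg_at_left_filter; exact: cF.
- by move=> t _; rewrite derive1E; have [_ ->] := dF t.
Qed.

Lemma zpow_cis (k : nat) (t : R) :
  zpow k (cis t) = cos (k%:R * t) +i* sin (k%:R * t).
Proof.
rewrite /zpow -exprnP; elim: k => [|k IH].
  by rewrite expr0 mul0r cos0 sin0.
rewrite exprSr IH -natr1 mulrDl mul1r cosD sinD.
by apply: complexP; rewrite ?Re_mul ?Im_mul /=; ring.
Qed.

Lemma cintegral_zpow_pos (k : nat) : cintegral (zpow k.+1) = 0.
Proof.
have [mRe mIm] := cmeasurable_zpow k.+1.
have bRe z : `|complex.Re (zpow k.+1 z)| <= 1.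
  have := normc_zpow k.+1 z; case: (zpow _ _) => a b /= ab.
  by rewrite -ab -sqrtr_sqr ler_wsqrtr // lerDl sqr_ge0.
have bIm z : `|complex.Im (zpow k.+1 z)| <= 1.
  have := normc_zpow k.+1 z; case: (zpow _ _) => a b /= ab.
  by rewrite -ab -sqrtr_sqr ler_wsqrtr // lerDr sqr_ge0.
have k0 : k.+1%:R != 0 :> R by rewrite pnatr_eq0.
have per : k.+1%:R * (2 * pi) = 0 + (pi *+ 2) *+ k.+1 :> R.
  by rewrite add0r -[RHS]mulr_natl -(mulr_natl pi).
apply: complexP => /=.
- apply: (@circle_mean_eq0 _ (fun t => cos (k.+1%:R * t))
    (fun t => k.+1%:R^-1 * sin (k.+1%:R * t))) => //.
  + by move=> t; rewrite zpow_cis.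
  + move=> t; apply: continuous_comp; last exact: continuous_cos.
    by apply: cvgM; [exact: cvg_cst | exact: cvg_id].
  + move=> t; apply: is_derive_eq.
    by rewrite /GRing.scale /=; field.
  + by rewrite per (periodicn (@sinD2pi R)) mulr0.
- apply: (@circle_mean_eq0 _ (fun t => sin (k.+1%:R * t))
    (fun t => - (k.+1%:R^-1 * cos (k.+1%:R * t)))) => //.
  + by move=> t; rewrite zpow_cis.
  + move=> t; apply: continuous_comp; last exact: continuous_sin.
    by apply: cvgM; [exact: cvg_cst | exact: cvg_id].
  + move=> t; apply: is_derive_eq.
    by rewrite /GRing.scale /=; field.
  + by rewrite per (periodicn (@cosD2pi R)) mulr0.
Qed.

Lemma cintegral_zpow n : cintegral (zpow n) = (n == 0)%:R.
Proof.
case: n => [[|k]|k].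
- by rewrite eqxx -[RHS](@cintegral_cst R); congr cintegral;
    apply/funext => z; rewrite zpow0.
- exact: cintegral_zpow_pos.
- rewrite (_ : zpow (Negz k) = fun z => (zpow k.+1 z)^*); last first.
    by apply/funext => z; rewrite zpowJ -NegzE.
  by rewrite cintegralJ ?cintegral_zpow_pos ?rmorph0 //; apply/L2_cintegrable/L2_zpow.
Qed.

Lemma dotL2_zpow n p : dotL2 (zpow n) (zpow p) = (n == p)%:R.
Proof.
rewrite -subr_eq0 -cintegral_zpow /dotL2; congr cintegral.
by apply/funext => z; rewrite zpowJ -zpowD.
Qed.

End characters.

(** * Polynomials approximating a threshold *)

Section threshold_polynomials.
Variable R : realType.
Implicit Types (a t x : R).

(** The cubic 3 t^2 - 2 t^3 maps [0, 1] to itself with attracting fixed points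
    0 and 1 and repelling fixed point 1/2: its iterates push every t to the nearer
    end of the interval. *)
Definition smoothstep t : R := t ^+ 2 * (3 - 2 * t).

Lemma smoothstep_itv n t : 0 <= t <= 1 -> 0 <= iter n smoothstep t <= 1.
Proof.
move=> t01; elim: n => // n; rewrite iterS /smoothstep.
move: (iter n _ t) => s /andP[s0 s1]; apply/andP; split.
  by rewrite mulr_ge0 ?sqr_ge0 //; lra.
rewrite -subr_ge0.
have -> : 1 - s ^+ 2 * (3 - 2 * s) = (1 - s) ^+ 2 * (1 + 2 * s) by ring.
by rewrite mulr_ge0 ?sqr_ge0 //; lra.
Qed.

Lemma smoothstep_sym n t : iter n smoothstep (1 - t) = 1 - iter n smoothstep t.
Proof. by elim: n => //= n ->; rewrite /smoothstep; ring. Qed.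

Lemma smoothstep_half n : iter n smoothstep 2^-1 = 2^-1.
Proof. by elim: n => //= n ->; rewrite /smoothstep; field. Qed.

(** Below 1/2 one step multiplies s by s (3 - 2 s), which is increasing in s
    there; its value c < 1 at the starting point bounds all later factors. *)
Lemma smoothstep_cvg0 t : 0 <= t < 2^-1 ->
  iter n smoothstep t @[n --> \oo] --> 0.
Proof.
move=> /andP[t0 th]; have th2 : 2 * t < 1 by lra.
pose c := t * (3 - 2 * t).
have c0 : 0 <= c by rewrite mulr_ge0 //; lra.
have c1 : c < 1.
  rewrite -subr_gt0 (_ : 1 - c = (1 - t) * (1 - 2 * t)); last by rewrite /c; ring.
  by rewrite mulr_gt0 //; lra.
have bnd n : 0 <= iter n smoothstep t <= t * c ^+ n.
  elim: n => [|n]; first by rewrite expr0 mulr1 /= t0 lexx.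
  rewrite iterS /smoothstep; move: (iter n _ t) => s /andP[s0 sn].
  have st : s <= t by apply: le_trans sn _; rewrite ler_piMr // exprn_ile1 // ltW.
  apply/andP; split; first by rewrite mulr_ge0 ?sqr_ge0 //; lra.
  apply: (@le_trans _ _ (s * c)); last by rewrite exprSr mulrA ler_wpM2r.
  rewrite expr2 -mulrA ler_wpM2l // -subr_ge0.
  have -> : c - s * (3 - 2 * s) = (t - s) * (3 - 2 * (t + s)) by rewrite /c; ring.
  by rewrite mulr_ge0 //; lra.
apply: (@squeeze_cvgr _ _ _ _ (cst 0) (fun n => t * c ^+ n)).
- by near=> n; exact: bnd.
- exact: cvg_cst.
- rewrite -[X in _ --> X](mulr0 t); apply: cvgM; first exact: cvg_cst.
  by apply: cvg_expr; rewrite ger0_norm.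
Unshelve. all: by end_near. Qed.

Lemma smoothstep_cvg1 t : 2^-1 < t <= 1 ->
  iter n smoothstep t @[n --> \oo] --> (1 : R).
Proof.
move=> t1; rewrite -[X in _ --> X]subr0.
have -> : (fun n => iter n smoothstep t) =
          (fun n => 1 - iter n smoothstep (1 - t)).
  by apply/funext => n; rewrite smoothstep_sym; ring.
apply: cvgB; first exact: cvg_cst.
by apply: smoothstep_cvg0; lra.
Qed.

(** An affine map of [-1, 1] into [0, 1] sends a to 1/2; the iterates of
    [smoothstep] then tend to the indicator function of x > a, except for the
    value 1/2 at x = a. The powers of 1 - r^2, where r is proportional to x - a,
    tend to the indicator function of x = a, and half of them corrects this
    value. *)
Lemma threshold_poly a : exists p : nat -> {poly R}, forall x, `|x| <= 1 ->
  (forall n, `|(p n).[x]| <= 2) /\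
  (p n).[x] @[n --> \oo] --> ((a < x)%R%:R : R).
Proof.
(* As |x - a| <= 1 + |a|, the values of l on [-1, 1] are in [-1/2, 1/2]. *)
pose l : {poly R} := (2 * (1 + `|a|))^-1 *: ('X - a%:P).
pose q n := iter n (fun q : {poly R} => q ^+ 2 * (3%:P - 2 *: q)) (2^-1%:P + l).
exists (fun n => q n - 2^-1 *: (1 - l ^+ 2) ^+ n) => x x1.
pose r := (2 * (1 + `|a|))^-1 * (x - a).
have a0 : 0 < 2 * (1 + `|a|) by have := normr_ge0 a; lra.
have lE : l.[x] = r by rewrite /l !hornerE.
clearbody l.
have qE n : (q n).[x] = iter n smoothstep (2^-1 + r).
  elim: n => [|n IH]; first by rewrite /q /= !hornerE lE.
  by rewrite /q iterS -/(q n) /= /smoothstep -IH !hornerE.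
have rh : `|r| <= 2^-1.
  rewrite normrM ger0_norm ?invr_ge0 ?(ltW a0) // mulrC ler_pdivrMr //.
  rewrite [leRHS]mulrA mulVf // mul1r; apply: le_trans (ler_normB _ _) _.
  by rewrite lerD2r.
have [rl rr] : - 2^-1 <= r /\ r <= 2^-1 by apply/andP; rewrite -ler_norml.
have r2 : 0 <= 1 - r ^+ 2 <= 1.
  by rewrite subr_ge0 gerBl sqr_ge0 andbT; nra.
have pE n : (q n - 2^-1 *: (1 - l ^+ 2) ^+ n).[x] =
    iter n smoothstep (2^-1 + r) - 2^-1 * (1 - r ^+ 2) ^+ n.
  by rewrite !hornerE qE lE.
split=> [n|].
  rewrite pE; have /andP[s0 s1] : 0 <= iter n smoothstep (2^-1 + r) <= 1.
    by apply: smoothstep_itv; lra.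
  have k0 : 0 <= (1 - r ^+ 2) ^+ n by case/andP: r2 => *; rewrite exprn_ge0.
  have k1 : (1 - r ^+ 2) ^+ n <= 1 by case/andP: r2 => *; rewrite exprn_ile1.
  by rewrite ler_norml; lra.
under eq_fun do rewrite pE.
have rE : (r == 0) = (x == a).
  by rewrite mulf_eq0 invr_eq0 (gt_eqF a0) /= subr_eq0.
have r0 : (0 < r) = (a < x) by rewrite pmulr_rgt0 ?invr_gt0 // subr_gt0.
have peak : x != a -> 2^-1 * (1 - r ^+ 2) ^+ n @[n --> \oo] --> (0 : R).
  rewrite -rE => rn0; rewrite -[X in _ --> X](mulr0 2^-1).
  apply: cvgM; first exact: cvg_cst.
  apply: cvg_expr; case/andP: r2 => r20 _; rewrite ger0_norm //.
  by rewrite gtrBl exprn_even_gt0.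
pose F n := iter n smoothstep (2^-1 + r) - 2^-1 * (1 - r ^+ 2) ^+ n.
have Flt : x < a -> F n @[n --> \oo] --> (0 : R).
  move=> xa; rewrite -[X in _ --> X]subr0.
  apply: cvgB; last by apply: peak; rewrite lt_eqF.
  have : r < 0 by rewrite lt_neqAle rE lt_eqF //= leNgt r0 -leNgt ltW.
  by move=> rn; apply: smoothstep_cvg0; lra.
have Fgt : a < x -> F n @[n --> \oo] --> (1 : R).
  move=> xa; rewrite -[X in _ --> X]subr0.
  apply: cvgB; last by apply: peak; rewrite gt_eqF.
  have : 0 < r by rewrite r0.
  by move=> rp; apply: smoothstep_cvg1; lra.
have Feq : x = a -> F n @[n --> \oo] --> (0 : R).
  move=> xa; rewrite /F; have -> : r = 0 by apply/eqP; rewrite rE xa.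
  under eq_fun do rewrite addr0 smoothstep_half expr0n subr0 expr1n mulr1 subrr.
  exact: cvg_cst.
by case: (ltgtP x a) => xa; [exact: Flt | exact: Fgt | exact: Feq].
Qed.

End threshold_polynomials.

(** * Uniqueness of Fourier coefficients *)

Section fourier_uniqueness.
Variable R : realType.
Local Notation C := R[i].
Local Notation T := (circle R).
Local Notation m := (circle_measure R).
Implicit Types (f g : T -> C) (x y : C) (h u v w : T -> R) (n : int).

Lemma sigma_algebra_preimage (aT rT : Type) (f : aT -> rT) (S : set (set aT)) :
  sigma_algebra setT S -> sigma_algebra setT [set B | S (f @^-1` B)].
Proof.
move=> [S0 SC SU]; split => [|B SB|B SB] /=.
- by rewrite preimage_set0.
- by have := SC _ SB; rewrite !setTD preimage_setC.
- by rewrite preimage_bigcup; exact: SU.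
Qed.

(** The Borel sets of the circle are generated by the half-planes a < x and
    a < y. *)
Lemma circle_measurable_sub (S : set (set T)) : sigma_algebra setT S ->
  (forall a : R, S [set z | a < complex.Re (val z)]) ->
  (forall a : R, S [set z | a < complex.Im (val z)]) ->
  measurable `<=` S.
Proof.
move=> sS SRe SIm.
have ray (f : T -> R) : (forall a, S [set z | a < f z]) ->
    forall B : set R, measurable B -> S (f @^-1` B).
  move=> Sf; have -> : @measurable _ R = <<s @RGenOInfty.G R >>.
    exact: RGenOInfty.measurableE.
  apply: smallest_sub; first exact: sigma_algebra_preimage.
  move=> _ [a ->] /=; have := Sf a; congr S; apply/funext => z /=.
  by rewrite in_itv /= andbT.
move=> _ [B mB <-]; rewrite setTI; move: B mB.
apply: smallest_sub; first exact: sigma_algebra_preimage.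
move=> _ [[A mA <-]|[A mA <-]] /=; rewrite setTI.
- exact: (ray _ SRe A mA).
- exact: (ray _ SIm A mA).
Qed.

Lemma Rintegral_mul_lim_eq0 (w : T -> R) (h_ : nat -> T -> R) h (M : R) :
  rintegrable w -> (forall k, measurable_fun setT (h_ k)) ->
  (forall k z, `|h_ k z| <= M) ->
  (forall z, h_ k z @[k --> \oo] --> h z) ->
  (forall k, \int[m]_z (w z * h_ k z) = 0) -> \int[m]_z (w z * h z) = 0.
Proof.
move=> iw mh hM hh w0; have mw := rintegrable_measurable iw.
have mlim : measurable_fun setT h.
  by apply: (measurable_fun_cvg (h := h_)) => // z _; exact: hh.
have iwh k : rintegrable (fun z => w z * h_ k z).
  apply: (rintegrable_le (v := fun z => M * `|w z|)).
  - exact: measurable_funM.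
  - by move=> z; rewrite normrM mulrC ler_wpM2r.
  - by apply: rintegrableZ; exact: integrable_norm.
have mwh : measurable_fun setT (fun z => (w z * h z)%:E).
  by apply/measurable_EFinP; exact: measurable_funM.
have cwh : {ae m, forall z, setT z ->
    (w z * h_ k z)%:E @[k --> \oo] --> (w z * h z)%:E}.
  apply: aeW => z _; apply: cvg_EFin; first by near=> k.
  by apply: cvgM; [exact: cvg_cst | exact: hh].
have idom : m.-integrable setT (fun z => (M * `|w z|)%:E).
  by apply: rintegrableZ; exact: integrable_norm.
have dom : {ae m, forall z, forall k, setT z ->
    (`|(w z * h_ k z)%:E| <= (M * `|w z|)%:E)%E}.
  by apply: aeW => z k _; rewrite lee_fin normrM mulrC ler_wpM2r.
have [_ _] := dominated_convergence measurableT
  (fun k => measurable_int _ (iwh k)) mwh cwh idom dom.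
have -> : (fun k => \int[m]_z (w z * h_ k z)%:E)%E = cst 0%E.
  apply/funext => k /=; have := w0 k; rewrite /Rintegral => e0.
  by rewrite -(fineK (integrable_fin_num measurableT (iwh k))) e0.
move=> /cvg_lim; rewrite lim_cst // => e0.
by rewrite /Rintegral -e0.
Unshelve. all: by end_near. Qed.

Variable g : T -> C.
Hypothesis Lg : L2 g.
Hypothesis g0 : forall n, fourier_coef g n = 0.

(** Asking for all Fourier coefficients of g h, and not just for its integral,
    makes this space stable under multiplication by trigonometric polynomials,
    hence by real polynomials in the coordinates x and y; the constant 1 belongs to
    it because the Fourier coefficients of g vanish. *)
Definition annihilated h :=
  [/\ measurable_fun setT h, exists M, forall z, `|h z| <= M &
      forall n, cintegral (fun z => g z * zpow n z * (h z)%:C) = 0].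

Lemma ae_bounded_real h M : measurable_fun setT h -> (forall z, `|h z| <= M) ->
  ae_bounded (fun z => (h z)%:C).
Proof.
move=> mh hM; split; first by split => //=; exact: measurable_cst.
exists M; apply: aeW => z /=.
by rewrite expr0n addr0 sqrtr_sqr.
Qed.

Lemma cintegrable_test h n : measurable_fun setT h ->
  (exists M, forall z, `|h z| <= M) ->
  cintegrable (fun z => g z * zpow n z * (h z)%:C).
Proof.
move=> mh [M hM].
have L : L2 (fun z => zpow n z * (h z)%:C * g z).
  apply: L2M => //; apply: ae_boundedM; first exact: ae_bounded_zpow.
  exact: ae_bounded_real hM.
have := L2_cintegrable L; congr cintegrable; apply/funext => z.
by rewrite mulrC mulrA.
Qed.

Lemma annihilated_cst : annihilated (cst 1).
Proof.
split; first exact: measurable_cst.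
  by exists 1 => z; rewrite normr1.
move=> n; have := g0 (- n); rewrite /fourier_coef /dotL2.
congr (_ = _); congr cintegral; apply/funext => z.
by rewrite -/(zpow (- n) z) zpowJ opprK mulr1.
Qed.

Lemma annihilatedD h u : annihilated h -> annihilated u ->
  annihilated (fun z => h z + u z).
Proof.
move=> [mh bh ah] [mu bu au]; split; first exact: measurable_funD.
  have [M hM] := bh; have [N uN] := bu; exists (M + N) => z.
  by apply: le_trans (ler_normD _ _) _; exact: lerD.
move=> n; rewrite -[RHS]addr0 -{1}(ah n) -(au n) -cintegralD;
  [|exact: cintegrable_test..].
by congr cintegral; apply/funext => z; rewrite rmorphD /= mulrDr.
Qed.

Lemma annihilatedZ (a : R) h : annihilated h -> annihilated (fun z => a * h z).
Proof.
move=> [mh bh ah]; split; first exact: measurable_funM.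
  have [M hM] := bh; exists (`|a| * M) => z.
  by rewrite normrM ler_wpM2l.
move=> n; rewrite -[RHS](mulr0 a%:C) -{1}(ah n) -cintegralZ;
  last exact: cintegrable_test.
by congr cintegral; apply/funext => z; rewrite rmorphM /= mulrCA.
Qed.

Lemma normr_Re_le x : `|complex.Re x| <= Normc.normc x.
Proof. by case: x => a b /=; rewrite -sqrtr_sqr ler_wsqrtr // lerDl sqr_ge0. Qed.

Lemma normr_Im_le x : `|complex.Im x| <= Normc.normc x.
Proof. by case: x => a b /=; rewrite -sqrtr_sqr ler_wsqrtr // lerDr sqr_ge0. Qed.

Lemma Re_val_zpow (z : T) :
  (complex.Re (val z))%:C = 2^-1 * (zpow 1 z + zpow (- 1) z).
Proof.
by rewrite -zpowJ /zpow expr1z ReJ_add mulrC.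
Qed.

Lemma Im_val_zpow (z : T) :
  (complex.Im (val z))%:C = (2 * 'i)^-1 * (zpow 1 z - zpow (- 1) z).
Proof.
rewrite -zpowJ /zpow expr1z.
have -> : val z - (val z)^* = (2 * 'i) * (complex.Im (val z))%:C.
  case: (val z) => a b; apply: complexP;
    rewrite ?Re_add ?Im_add ?Re_opp ?Im_opp ?Re_conj ?Im_conj ?Re_mul ?Im_mul /=;
    ring.
by rewrite mulKf // mulf_neq0 ?pnatr_eq0 // neq0Ci.
Qed.

Lemma annihilated_mul_coord (c : T -> R) (x y : C) h :
  measurable_fun setT c -> (forall z, `|c z| <= 1) ->
  (forall z, (c z)%:C = x * (zpow 1 z + y * zpow (- 1) z)) ->
  annihilated h -> annihilated (fun z => c z * h z).
Proof.
move=> mc c1 cE [mh bh ah].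
have bch : exists M, forall z, `|c z * h z| <= M.
  have [M hM] := bh; exists M => z; rewrite normrM.
  by apply: le_trans (hM z); rewrite ler_piMl.
split => // [|n]; first exact: measurable_funM.
transitivity (x * (cintegral (fun z => g z * zpow (n + 1) z * (h z)%:C) +
   y * cintegral (fun z => g z * zpow (n - 1) z * (h z)%:C))); last first.
  by rewrite !ah mulr0 addr0 mulr0.
rewrite -cintegralZ; last exact: cintegrable_test.
rewrite -cintegralD; last 2 first.
- exact: cintegrable_test.
- by apply: cintegrableZ; exact: cintegrable_test.
rewrite -cintegralZ; last first.
  by apply: cintegrableD; [|apply: cintegrableZ]; exact: cintegrable_test.
congr cintegral; apply/funext => z.
by rewrite rmorphM /= cE !zpowD; ring.
Qed.

(** The two coordinate functions Re z and Im z have these properties; the bound 1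
    is what the threshold polynomials need. *)
Definition is_coord (c : T -> R) :=
  [/\ measurable_fun setT c, forall z, `|c z| <= 1 &
      forall h, annihilated h -> annihilated (fun z => c z * h z)].

Lemma is_coord_Re : is_coord (fun z => complex.Re (val z)).
Proof.
have [mRe _] := @cmeasurable_val R.
have c1 (z : T) : `|complex.Re (val z)| <= 1.
  by rewrite -(normc_zpow 1 z) /zpow expr1z normr_Re_le.
split=> // h; apply: (@annihilated_mul_coord _ 2^-1 1) => // z.
by rewrite mul1r Re_val_zpow.
Qed.

Lemma is_coord_Im : is_coord (fun z => complex.Im (val z)).
Proof.
have [_ mIm] := @cmeasurable_val R.
have c1 (z : T) : `|complex.Im (val z)| <= 1.
  by rewrite -(normc_zpow 1 z) /zpow expr1z normr_Im_le.
split=> // h; apply: (@annihilated_mul_coord _ (2 * 'i)^-1 (-1)) => // z.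
by rewrite mulN1r Im_val_zpow.
Qed.

Lemma annihilated_mul_poly c h (p : {poly R}) : is_coord c ->
  annihilated h -> annihilated (fun z => p.[c z] * h z).
Proof.
move=> [mc c1 Vc] Vh; elim/poly_ind: p => [|p a IH].
  under eq_fun do rewrite horner0.
  exact: annihilatedZ.
under eq_fun do rewrite hornerMXaddC mulrDl.
apply: annihilatedD; last exact: annihilatedZ.
by under eq_fun do rewrite mulrAC mulrC; exact: Vc.
Qed.

(** Dominated convergence: g is integrable and the functions h_ are uniformly
    bounded. *)
Lemma annihilated_lim (h_ : nat -> T -> R) h (M : R) :
  (forall k, annihilated (h_ k)) -> (forall k z, `|h_ k z| <= M) ->
  (forall z, h_ k z @[k --> \oo] --> h z) -> annihilated h.
Proof.
move=> Vh hM hh.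
have mh k : measurable_fun setT (h_ k) by have [] := Vh k.
have mlim : measurable_fun setT h.
  by apply: (measurable_fun_cvg (h := h_)) => // z _; exact: hh.
split => // [|n].
  exists M => z; apply: (cvgr_to_le (cvg_norm (hh z))).
  by near=> k; exact: hM.
have ign : cintegrable (fun z => g z * zpow n z).
  by apply: cintegrableM => //; exact: L2_zpow.
have [iRe iIm] := ign.
have vh k : cintegral (fun z => g z * zpow n z * (h_ k z)%:C) = 0.
  by have [] := Vh k.
apply: complexP => /=.
- under eq_Rintegral do rewrite Re_mul /= mulr0 subr0.
  apply: (Rintegral_mul_lim_eq0 iRe mh hM hh) => k.
  have /(congr1 (@complex.Re R)) /= := vh k.
  by under eq_Rintegral do rewrite Re_mul /= mulr0 subr0.
- under eq_Rintegral do rewrite Im_mul /= mulr0 add0r.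
  apply: (Rintegral_mul_lim_eq0 iIm mh hM hh) => k.
  have /(congr1 (@complex.Im R)) /= := vh k.
  by under eq_Rintegral do rewrite Im_mul /= mulr0 add0r.
Unshelve. all: by end_near. Qed.

(** Quantifying over all annihilated functions makes this family stable under
    intersections, because indicator functions multiply. *)
Definition annihilating_set (A : set T) :=
  forall h, annihilated h -> annihilated (fun z => \1_A z * h z).

(** The indicator function of c > a is the bounded pointwise limit of
    polynomials in c. *)
Lemma annihilating_ray c a : is_coord c -> annihilating_set [set z | a < c z].
Proof.
move=> cc h Vh; have [mc c1 _] := cc; have [mh [M hM] _] := Vh.
have [p pP] := threshold_poly a.
apply: (@annihilated_lim (fun k z => (p k).[c z] * h z) _ (2 * M)).
- by move=> k; exact: annihilated_mul_poly.
- by move=> k z; rewrite normrM ler_pM //; have [->] := pP _ (c1 z).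
- move=> z; apply: cvgM; last exact: cvg_cst.
  have -> : \1_[set z0 | a < c z0] z = (a < c z)%R%:R :> R.
    by rewrite indicE; congr (nat_of_bool _)%:R; apply/idP/idP; rewrite inE.
  by have [] := pP _ (c1 z).
Qed.

Lemma sigma_algebra_annihilating : sigma_algebra setT annihilating_set.
Proof.
have compl A : annihilating_set A -> annihilating_set (~` A).
  move=> SA h Vh.
  have := annihilatedD Vh (annihilatedZ (-1) (SA h Vh)).
  congr annihilated; apply/funext => z.
  by rewrite !indicE in_setC; case: (z \in A) => /=; ring.
have inter A B : annihilating_set A -> annihilating_set B ->
    annihilating_set (A `&` B).
  move=> SA SB h Vh; have := SA _ (SB _ Vh); congr annihilated.
  by apply/funext => z; rewrite indicI /= mulrA.
have e0 : annihilating_set set0.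
  by move=> h Vh; under eq_fun do rewrite indic0; exact: (annihilatedZ 0).
split=> // [A SA|A SA]; first by rewrite setTD; exact: compl.
have SU k : annihilating_set (\big[setU/set0]_(i < k) A i).
  elim: k => [|k IH]; first by rewrite big_ord0.
  rewrite big_ord_recr /= -[X in annihilating_set X]setCK setCU.
  by apply/compl/inter; apply/compl.
move=> h Vh; have [_ [M hM] _] := Vh.
apply: (@annihilated_lim
  (fun k z => \1_(\big[setU/set0]_(i < k) A i) z * h z) _ M).
- by move=> k; exact: SU.
- move=> k z; rewrite normrM indicE; apply: le_trans (hM z).
  by rewrite ler_piMl //; case: (_ \in _); rewrite ?normr1 ?normr0.
- move=> z; apply: cvgM; last exact: cvg_cst.
  have [[i _ Aiz]|nAz] := pselect ((\bigcup_k A k) z).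
    apply: cvg_near_cst; near=> k.
    rewrite !indicE !mem_set //; first by exists i.
    rewrite -bigcup_mkord; exists i => //=; near: k; exact: nbhs_infty_gt.
  apply: cvg_near_cst; near=> k.
  rewrite !indicE !memNset // -bigcup_mkord => -[i _ Aiz]; apply: nAz.
  by exists i.
Unshelve. all: by end_near. Qed.

(** It is enough to use the set A where w is positive: the functions w 1_A and
    -w 1_(~A) are nonnegative with zero integral. *)
Lemma Rintegral_indic_eq0 w : rintegrable w ->
  (forall A, measurable A -> \int[m]_z (w z * \1_A z) = 0) ->
  {ae m, forall z, w z = 0}.
Proof.
move=> iw w0; have mw := rintegrable_measurable iw.
have i1 A : measurable A -> rintegrable (fun z => w z * \1_A z).
  move=> mA; apply: (rintegrable_le (v := fun z => `|w z|)).
  - by apply: measurable_funM => //; exact: measurable_indic.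
  - move=> z; rewrite normrM ler_piMr // indicE.
    by case: (_ \in _); rewrite ?normr1 ?normr0.
  - exact: integrable_norm.
pose A := [set z | 0 < w z].
have mA : measurable A.
  rewrite -[A]setTI; have := mw measurableT `]0, +oo[%classic (measurable_itv _).
  by congr measurable; apply/funext => z /=; rewrite in_itv /= andbT.
have mAc : measurable (~` A) by exact: measurableC.
have pos : {ae m, forall z, w z * \1_A z = 0}.
  apply: Rintegral_nonneg_eq0 (i1 _ mA) _ (w0 _ mA) => z.
  rewrite indicE; have [zA|zA] := boolP (z \in A); last by rewrite mulr0.
  by rewrite mulr1 ltW //; rewrite inE in zA.
have neg : {ae m, forall z, - (w z * \1_(~` A) z) = 0}.
  apply: Rintegral_nonneg_eq0.
  - exact/rintegrableN/i1.
  - move=> z; rewrite indicE in_setC.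
    have [zA|zA] := boolP (z \in A); first by rewrite mulr0 oppr0.
    rewrite mulr1 oppr_ge0 leNgt; apply/negP => wz.
    by move/negP: zA; apply; rewrite inE.
  - under eq_Rintegral do rewrite -mulN1r.
    by rewrite RintegralZl ?w0 ?mulr0 //; exact: i1.
apply: filterS2 pos neg => z; rewrite !indicE in_setC.
by case: (z \in A); rewrite /= ?mulr1 // => _ /eqP; rewrite oppr_eq0 => /eqP.
Qed.

(** The annihilating sets form a sigma-algebra that contains the half-planes, so
    every Borel set is annihilating and g has integral zero on it. *)
Theorem fourier_coef_inj0 : g = cst 0 %[ae m].
Proof.
have VA A : measurable A -> annihilated (\1_A).
  move=> mA; have : annihilating_set A.
    apply: circle_measurable_sub mA.
    - exact: sigma_algebra_annihilating.
    - by move=> a; apply: annihilating_ray; exact: is_coord_Re.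
    - by move=> a; apply: annihilating_ray; exact: is_coord_Im.
  move=> /(_ _ annihilated_cst); congr annihilated.
  by apply/funext => z; rewrite mulr1.
have [iRe iIm] := L2_cintegrable Lg.
have gA A : measurable A -> cintegral (fun z => g z * (\1_A z)%:C) = 0.
  move=> mA; have [_ _ /(_ 0)] := VA A mA; congr (_ = _); congr cintegral.
  by apply/funext => z; rewrite zpow0 mulr1.
have gRe : {ae m, forall z, complex.Re (g z) = 0}.
  apply: Rintegral_indic_eq0 => // A mA.
  have /(congr1 (@complex.Re R)) /= := gA A mA.
  by under eq_Rintegral do rewrite Re_mul /= mulr0 subr0.
have gIm : {ae m, forall z, complex.Im (g z) = 0}.
  apply: Rintegral_indic_eq0 => // A mA.
  have /(congr1 (@complex.Im R)) /= := gA A mA.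
  by under eq_Rintegral do rewrite Im_mul /= mulr0 add0r.
by apply: filterS2 gRe gIm => z re im _; exact: complexP.
Qed.

End fourier_uniqueness.

(** * Fourier series and the Riesz projection *)

Section fourier_series.
Variable R : realType.
Local Notation C := R[i].
Local Notation T := (circle R).
Local Notation m := (circle_measure R).
Implicit Types (f g h u : T -> C) (x y : C) (c : nat -> C) (k N : nat) (n : int).

Definition L2lim (u_ : nat -> T -> C) h := forall e : R, 0 < e ->
  exists N, forall k, (N <= k)%N -> normL2 (fun z => h z - u_ k z) <= e.

Lemma EFin_sqr_normL2 f : L2 f ->
  (\int[m]_z (Normc.normc (f z) ^+ 2)%:E = (normL2 f ^+ 2)%:E)%E.
Proof.
move=> Lf; rewrite sqr_normL2 /Rintegral fineK //.
exact: integrable_fin_num (L2_sqr Lf).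
Qed.

Lemma realC_inj (a b : R) : a%:C = b%:C -> a = b.
Proof. by case. Qed.

Lemma L2_complete_complex (u_ : nat -> T -> C) :
  (forall k, L2 (u_ k)) ->
  (forall e : R, 0 < e -> exists N, forall i j, (N <= i)%N -> (N <= j)%N ->
     normL2 (fun z => u_ i z - u_ j z) ^+ 2 <= e) ->
  exists2 h, L2 h & L2lim u_ h.
Proof.
move=> Lu cau.
have mRe k : measurable_fun setT (fun z => complex.Re (u_ k z)) by have [] := Lu k.
have mIm k : measurable_fun setT (fun z => complex.Im (u_ k z)) by have [] := Lu k.
have [e e0|v [mv vlim]] := L2_complete (mu := m) mRe.
  have [N NP] := cau e e0; exists N => i j Ni Nj.
  have Lij := L2B (Lu i) (Lu j).
  apply: le_trans (_ : (normL2 (fun z => u_ i z - u_ j z) ^+ 2)%:E <= _)%E; last first.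
    by rewrite lee_fin NP.
  rewrite -EFin_sqr_normL2 //; apply: ge0_le_integral => //.
  - by move=> z _; rewrite lee_fin sqr_ge0.
  - by apply/measurable_EFinP/measurable_funX; exact: measurable_funB.
  - exact/measurable_EFinP/cmeasurable_sqr/L2_cmeasurable.
  - by move=> z _; rewrite lee_fin normc_sqrE Re_add Re_opp lerDl sqr_ge0.
have [e e0|w [mw wlim]] := L2_complete (mu := m) mIm.
  have [N NP] := cau e e0; exists N => i j Ni Nj.
  have Lij := L2B (Lu i) (Lu j).
  apply: le_trans (_ : (normL2 (fun z => u_ i z - u_ j z) ^+ 2)%:E <= _)%E; last first.
    by rewrite lee_fin NP.
  rewrite -EFin_sqr_normL2 //; apply: ge0_le_integral => //.
  - by move=> z _; rewrite lee_fin sqr_ge0.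
  - by apply/measurable_EFinP/measurable_funX; exact: measurable_funB.
  - exact/measurable_EFinP/cmeasurable_sqr/L2_cmeasurable.
  - by move=> z _; rewrite lee_fin normc_sqrE Im_add Im_opp lerDr sqr_ge0.
pose h z := v z +i* w z.
have mh : cmeasurable h by [].
have hsqr e : 0 < e -> exists N, forall k, (N <= k)%N ->
    (\int[m]_z (Normc.normc (h z - u_ k z) ^+ 2)%:E <= e%:E)%E.
  move=> e0; have e20 : 0 < e / 2 by rewrite divr_gt0.
  have [N1 N1P] := vlim _ e20; have [N2 N2P] := wlim _ e20.
  exists (maxn N1 N2) => k; rewrite geq_max => /andP[k1 k2].
  under eq_integral do rewrite normc_sqrE Re_add Im_add Re_opp Im_opp /= EFinD.
  rewrite ge0_integralD //=.
  - rewrite [e]splitr EFinD; apply: leeD; [exact: N1P | exact: N2P].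
  - by move=> z _; rewrite lee_fin sqr_ge0.
  - by apply/measurable_EFinP/measurable_funX; exact: measurable_funB.
  - by move=> z _; rewrite lee_fin sqr_ge0.
  - by apply/measurable_EFinP/measurable_funX; exact: measurable_funB.
have Lhu : exists N, forall k, (N <= k)%N -> L2 (fun z => h z - u_ k z).
  have [N NP] := hsqr 1 ltr01; exists N => k Nk; apply/L2P.
  have mhu : cmeasurable (fun z => h z - u_ k z).
    by apply: cmeasurableD => //; apply/cmeasurableN/L2_cmeasurable.
  split=> //; apply/integrableP; split.
    by apply/measurable_EFinP; exact: cmeasurable_sqr.
  under eq_integral do rewrite gee0_abs ?lee_fin ?sqr_ge0 //.
  exact: le_lt_trans (NP _ Nk) (ltry _).
have [N0 N0P] := Lhu.
have Lh : L2 h.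
  have := L2D (N0P N0 (leqnn _)) (Lu N0); congr L2.
  by apply/funext => z; rewrite subrK.
exists h => // e e0; have [N NP] := hsqr _ (exprn_gt0 2 e0).
exists N => k Nk; have := NP k Nk.
rewrite EFin_sqr_normL2 ?lee_fin; last exact: L2B.
by rewrite ler_pXn2r // nnegrE ?normL2_ge0 // ltW.
Qed.

Lemma le_normc_eq0 x (M : R) :
  (forall e : R, 0 < e -> Normc.normc x <= M * e) -> x = 0.
Proof.
move=> xM; apply: Normc.eq0_normc; apply/eqP.
rewrite eq_le normc_ge0 andbT; apply/ler_addgt0Pr => e e0; rewrite add0r.
have M0 : 0 < `|M| + 1 by rewrite ltr_wpDl.
apply: le_trans (xM (e / (`|M| + 1)) (divr_gt0 e0 M0)) _.
rewrite mulrA ler_pdivrMr // mulrC ler_pM2l //.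
by apply: le_trans (ler_norm _) _; rewrite lerDl.
Qed.

Lemma dotL2_lim (u_ : nat -> T -> C) h g x N : (forall k, L2 (u_ k)) ->
  L2 h -> L2 g -> L2lim u_ h ->
  (forall k, (N <= k)%N -> dotL2 (u_ k) g = x) -> dotL2 h g = x.
Proof.
move=> Lu Lh Lg uh ux; apply/eqP; rewrite -subr_eq0; apply/eqP.
apply: (@le_normc_eq0 _ (normL2 g)) => e e0.
have [M MP] := uh e e0; pose k := maxn N M.
rewrite -(ux k) ?leq_maxl // -dotL2Bl //.
apply: le_trans (cauchy_schwarz (L2B Lh (Lu k)) Lg) _.
by rewrite mulrC ler_wpM2l ?normL2_ge0 // MP // leq_maxr.
Qed.

Lemma fourier_coefE f n : fourier_coef f n = dotL2 f (zpow n).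
Proof. by []. Qed.

Lemma fourier_coefD f g n : L2 f -> L2 g ->
  fourier_coef (fun z => f z + g z) n = fourier_coef f n + fourier_coef g n.
Proof. by move=> Lf Lg; rewrite fourier_coefE dotL2Dl //; exact: L2_zpow. Qed.

Lemma fourier_coefB f g n : L2 f -> L2 g ->
  fourier_coef (fun z => f z - g z) n = fourier_coef f n - fourier_coef g n.
Proof. by move=> Lf Lg; rewrite fourier_coefE dotL2Bl //; exact: L2_zpow. Qed.

Lemma fourier_coefZ x f n : L2 f ->
  fourier_coef (fun z => x * f z) n = x * fourier_coef f n.
Proof. by move=> Lf; rewrite fourier_coefE dotL2Zl //; exact: L2_zpow. Qed.

Lemma fourier_coef_zpow p n : fourier_coef (zpow p : T -> C) n = (p == n)%:R.
Proof. exact: dotL2_zpow. Qed.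

Lemma fourier_coefJ f n : L2 f ->
  fourier_coef (fun z => (f z)^*) n = (fourier_coef f (- n))^*.
Proof.
move=> Lf; rewrite !fourier_coefE -dotL2J //; last exact: L2_zpow.
rewrite /dotL2; congr cintegral; apply/funext => z.
by rewrite mulrC zpowJ.
Qed.

Lemma fourier_coefM_zpow f n p :
  fourier_coef (fun z => zpow p z * f z) n = fourier_coef f (n - p).
Proof.
rewrite /fourier_coef /dotL2; congr cintegral; apply/funext => z.
by rewrite -!/(zpow _ _) !zpowJ opprB zpowD; ring.
Qed.

Lemma fourier_coef_inj f g : L2 f -> L2 g ->
  (forall n, fourier_coef f n = fourier_coef g n) -> f = g %[ae m].
Proof.
move=> Lf Lg fg.
have /fourier_coef_inj0 : forall n, fourier_coef (fun z => f z - g z) n = 0.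
  by move=> n; rewrite fourier_coefB // fg subrr.
move=> /(_ (L2B Lf Lg)); apply: filterS => z /(_ I) /= /eqP.
by rewrite subr_eq0 => /eqP.
Qed.

Definition taylor_sum c N : T -> C := fun z => \sum_(k < N) c k * zpow k z.

Lemma taylor_sum0 c : taylor_sum c 0 = fun=> 0.
Proof. by apply/funext => z; rewrite /taylor_sum big_ord0. Qed.

Lemma taylor_sumS c N : taylor_sum c N.+1 = fun z => taylor_sum c N z + c N * zpow N z.
Proof. by apply/funext => z; rewrite /taylor_sum big_ord_recr. Qed.

Lemma ae_bounded_taylor_sum c N : ae_bounded (taylor_sum c N).
Proof.
elim: N => [|N IH]; first by rewrite taylor_sum0; exact: ae_bounded_cst.
rewrite taylor_sumS; apply: ae_boundedD => //.
apply: ae_boundedM; [exact: ae_bounded_cst | exact: ae_bounded_zpow].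
Qed.

Lemma L2_taylor_sum c N : L2 (taylor_sum c N).
Proof. exact/ae_bounded_L2/ae_bounded_taylor_sum. Qed.

Lemma fourier_coef_cst0 n : fourier_coef (fun _ : T => (0 : C)) n = 0.
Proof.
rewrite -[RHS](mul0r (fourier_coef (zpow 0) n)) -fourier_coefZ; last exact: L2_zpow.
have -> // : (fun _ : T => (0 : C)) = fun z => 0 * zpow 0 z.
by apply/funext => z; rewrite mul0r.
Qed.

Lemma fourier_coef_taylor_sum_neg c N n : n < 0 -> fourier_coef (taylor_sum c N) n = 0.
Proof.
move=> n0; elim: N => [|N IH]; first by rewrite taylor_sum0 fourier_coef_cst0.
have Lz := L2_zpow R N.
rewrite taylor_sumS fourier_coefD ?fourier_coefZ //; [|exact: L2_taylor_sum|exact: L2Z].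
by rewrite IH fourier_coef_zpow gt_eqF ?mulr0 ?addr0 //; exact: lt_le_trans n0 _.
Qed.

Lemma fourier_coef_taylor_sum c N k :
  fourier_coef (taylor_sum c N) k = if (k < N)%N then c k else 0.
Proof.
elim: N => [|N IH]; first by rewrite taylor_sum0 fourier_coef_cst0.
have Lz := L2_zpow R N.
rewrite taylor_sumS fourier_coefD ?fourier_coefZ //; [|exact: L2_taylor_sum|exact: L2Z].
rewrite IH fourier_coef_zpow eqz_nat ltnS (leq_eqVlt k N) (eq_sym k N).
by case: eqP => [->|_]; rewrite ?ltnn /= ?mulr1 ?add0r // mulr0 addr0.
Qed.

Lemma dotL2_taylor_sumr f c N : L2 f ->
  dotL2 f (taylor_sum c N) = \sum_(k < N) (c k)^* * fourier_coef f k.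
Proof.
move=> Lf; elim: N => [|N IH].
  rewrite taylor_sum0 big_ord0 /dotL2; under eq_fun do rewrite rmorph0 mulr0.
  exact: cintegral_cst.
have Lz := L2_zpow R N.
rewrite taylor_sumS dotL2Dr ?dotL2Zr //; [|exact: L2_taylor_sum|exact: L2Z].
by rewrite big_ord_recr /= IH.
Qed.

Lemma dotL2_taylor_sum c i j : (i <= j)%N ->
  dotL2 (taylor_sum c i) (taylor_sum c j) = (\sum_(k < i) Normc.normc (c k) ^+ 2)%:C.
Proof.
move=> ij; rewrite dotL2_taylor_sumr; last exact: L2_taylor_sum.
rewrite (big_ord_widen j (fun k => Normc.normc (c k) ^+ 2) ij).
rewrite [in RHS]big_mkcond /= rmorph_sum /=; apply: eq_bigr => k _; rewrite fourier_coef_taylor_sum.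
by case: ifP => _; rewrite ?mulr0 // mulrC mul_conjc.
Qed.

Lemma normL2_taylor_sumB c i j : (i <= j)%N ->
  normL2 (fun z => taylor_sum c j z - taylor_sum c i z) ^+ 2 =
  \sum_(k < j) Normc.normc (c k) ^+ 2 - \sum_(k < i) Normc.normc (c k) ^+ 2.
Proof.
move=> ij; have Li := L2_taylor_sum c i; have Lj := L2_taylor_sum c j.
apply: realC_inj.
rewrite -dotL2_norm dotL2Bl ?dotL2Br //; try exact: L2B.
rewrite (dotL2J Li Lj) !dotL2_taylor_sum // conjcR rmorphB /=; ring.
Qed.

Lemma normL2_subC f g : L2 f -> L2 g ->
  normL2 (fun z => f z - g z) = normL2 (fun z => g z - f z).
Proof.
move=> Lf Lg; congr Num.sqrt; apply: eq_Rintegral => z _.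
by rewrite -normcN opprB.
Qed.

(** The distance between two partial sums is the difference of the partial sums
    of a convergent series of squared moduli. *)
Lemma riesz_fischer c (B : R) :
  (forall N, \sum_(k < N) Normc.normc (c k) ^+ 2 <= B) ->
  exists2 h, L2 h & L2lim (taylor_sum c) h.
Proof.
move=> cB; pose S N := \sum_(k < N) Normc.normc (c k) ^+ 2.
have ndS : {homo S : i j / (i <= j)%N >-> i <= j}.
  apply/nondecreasing_seqP => i; rewrite /S big_ord_recr /= lerDl; exact: sqr_ge0.
have cS : cvgn S.
  by apply: nondecreasing_is_cvgn => //; exists B => _ [i _ <-]; exact: cB.
apply: L2_complete_complex => [k|e e0]; first exact: L2_taylor_sum.
have /cvgrPdist_le /(_ (e / 2)) := cS; rewrite divr_gt0 // => /(_ isT) [N _ NP].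
have Sij i j : (N <= i)%N -> (N <= j)%N -> S i - S j <= e.
  move=> /NP /= + /NP /=; rewrite !ler_norml; lra.
exists N => i j Ni Nj; have [ij|ji] := leqP i j.
  rewrite normL2_subC; [|exact: L2_taylor_sum..].
  by rewrite normL2_taylor_sumB // Sij.
by rewrite normL2_taylor_sumB ?Sij // ltnW.
Qed.

Lemma bessel f N : L2 f ->
  \sum_(k < N) Normc.normc (fourier_coef f k) ^+ 2 <= normL2 f ^+ 2.
Proof.
move=> Lf; pose c k := fourier_coef f k; have Lp := L2_taylor_sum c N.
suff <- : normL2 (fun z => f z - taylor_sum c N z) ^+ 2 +
    \sum_(k < N) Normc.normc (c k) ^+ 2 = normL2 f ^+ 2.
  by rewrite lerDr sqr_ge0.
apply: realC_inj; rewrite rmorphD /=.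
have fp : dotL2 f (taylor_sum c N) = (\sum_(k < N) Normc.normc (c k) ^+ 2)%:C.
  rewrite dotL2_taylor_sumr // rmorph_sum /=; apply: eq_bigr => k _.
  by rewrite mulrC mul_conjc.
rewrite -!dotL2_norm dotL2Bl ?dotL2Br //; try exact: L2B.
by rewrite (dotL2J Lf Lp) fp dotL2_taylor_sum // conjcR; ring.
Qed.

Lemma H2_L2 f : H2 f -> L2 f.
Proof. by case. Qed.

(** The projection of f on H^2 is the sum of the part of the Fourier series of f
    with nonnegative exponents; its coefficients are square summable by Bessel's
    inequality. *)
Lemma riesz_projection f : L2 f -> exists2 h, H2 h &
  L2lim (taylor_sum (fun k => fourier_coef f k)) h /\
  (forall k, fourier_coef h k = fourier_coef f k).
Proof.
move=> Lf; pose c k := fourier_coef f k.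
have [h Lh ch] := @riesz_fischer c _ (fun N => bessel N Lf).
exists h; last split=> //.
- split=> // n n0; apply: (dotL2_lim (N := 0) _ Lh (L2_zpow R n) ch) => k.
    exact: L2_taylor_sum.
  by move=> _; exact: fourier_coef_taylor_sum_neg.
- move=> k; apply: (dotL2_lim (N := k.+1) _ Lh (L2_zpow R k) ch) => [i|i ki].
    exact: L2_taylor_sum.
  by rewrite -fourier_coefE fourier_coef_taylor_sum ki.
Qed.

(** The Taylor sums converge to some function h by Riesz-Fischer, and h has the
    Fourier coefficients of f, so it is f. *)
Lemma H2_taylor_sum_lim f : H2 f -> L2lim (taylor_sum (fun k => fourier_coef f k)) f.
Proof.
move=> [Lf f0]; have [h [Lh h0] [hlim hk]] := riesz_projection Lf.
have fh : f = h %[ae m].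
  apply: fourier_coef_inj => // -[k|k]; first by rewrite hk.
  by rewrite f0 // h0.
move=> e e0; have [N NP] := hlim e e0; exists N => k Nk.
have Lp := L2_taylor_sum (fun k => fourier_coef f k) k.
rewrite (normL2_ae_eq (L2B Lf Lp) (L2B Lh Lp)) ?NP //.
by apply: filterS fh => z /(_ I) ->.
Qed.

(** True for Taylor sums by computation, hence for their limit h. *)
Lemma dotL2_H2_eq0 g h : L2 g -> (forall k, fourier_coef g k = 0) -> H2 h ->
  dotL2 g h = 0.
Proof.
move=> Lg g0 Hh; have Lh := H2_L2 Hh; rewrite (dotL2J Lh Lg).
rewrite (dotL2_lim (N := 0) (fun k => L2_taylor_sum _ k) Lh Lg (H2_taylor_sum_lim Hh) (x := 0)).
  by rewrite rmorph0.
move=> k _; rewrite (dotL2J Lg (L2_taylor_sum _ _)) dotL2_taylor_sumr // big1 ?rmorph0 //.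
by move=> i _; rewrite g0 mulr0.
Qed.

Lemma H2D f g : H2 f -> H2 g -> H2 (fun z => f z + g z).
Proof.
move=> [Lf f0] [Lg g0]; split; first exact: L2D.
by move=> n n0; rewrite fourier_coefD // f0 // g0 // addr0.
Qed.

Lemma H2Z x f : H2 f -> H2 (fun z => x * f z).
Proof.
move=> [Lf f0]; split; first exact: L2Z.
by move=> n n0; rewrite fourier_coefZ // f0 // mulr0.
Qed.

Lemma H2B f g : H2 f -> H2 g -> H2 (fun z => f z - g z).
Proof.
move=> [Lf f0] [Lg g0]; split; first exact: L2B.
by move=> n n0; rewrite fourier_coefB // f0 // g0 // subr0.
Qed.

Lemma H2_zpow k : H2 (zpow k : T -> C).
Proof.
split=> [|n n0]; first exact: L2_zpow.
by rewrite fourier_coef_zpow gt_eqF //; exact: lt_le_trans n0 _.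
Qed.

Lemma H2_cst x : H2 (fun _ : T => x).
Proof.
have := H2Z x (H2_zpow 0); congr H2; apply/funext => z.
by rewrite zpow0 mulr1.
Qed.

Lemma H2_taylor_sum c N : H2 (taylor_sum c N).
Proof. by split; [exact: L2_taylor_sum | exact: fourier_coef_taylor_sum_neg]. Qed.

Lemma dotL2Ml u f g : dotL2 (fun z => u z * f z) g = dotL2 f (fun z => (u z)^* * g z).
Proof.
rewrite /dotL2; congr cintegral; apply/funext => z.
by rewrite rmorphM /= conjCK mulrCA mulrA.
Qed.

(** A negative Fourier coefficient of u f is the inner product of f with
    conj(u) z^n, whose Fourier coefficients of nonnegative index vanish. *)
Lemma H2M u f : ae_bounded u -> H2 u -> H2 f -> H2 (fun z => u z * f z).
Proof.
move=> bu [Lu u0] Hf; have Lf := H2_L2 Hf; split; first exact: L2M.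
move=> n n0; rewrite fourier_coefE dotL2Ml.
have Lg : L2 (fun z => (u z)^* * zpow n z).
  by apply: L2M; [exact: ae_boundedJ | exact: L2_zpow].
rewrite (dotL2J Lg Lf) dotL2_H2_eq0 ?rmorph0 // => k.
have -> : (fun z => (u z)^* * zpow n z) = (fun z => zpow n z * (u z)^*).
  by apply/funext => z; rewrite mulrC.
rewrite fourier_coefM_zpow fourier_coefJ // u0 ?rmorph0 //.
by rewrite opprB subr_lt0; exact: lt_le_trans n0 _.
Qed.

End fourier_series.

(** * Model spaces *)

Section model_spaces.
Variable R : realType.
Local Notation C := R[i].
Local Notation T := (circle R).
Local Notation m := (circle_measure R).
Implicit Types (f g h p q u : T -> C) (x y : C) (k N : nat) (n : int).

Lemma inner_H2 u : inner_function u -> H2 u.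
Proof. by case. Qed.

Lemma inner_ae_bounded u : inner_function u -> ae_bounded u.
Proof.
move=> [[Lu _] u1]; split; first exact: L2_cmeasurable.
by exists 1; apply: filterS u1 => z; rewrite normcE => -[->].
Qed.

Lemma inner_mulJ u : inner_function u -> {ae m, forall z, u z * (u z)^* = 1}.
Proof.
move=> [_ u1]; apply: filterS u1 => z; rewrite mul_conjc normcE => -[->].
by rewrite expr1n.
Qed.

Lemma inner_isometry u f g : inner_function u -> L2 f -> L2 g ->
  dotL2 (fun z => u z * f z) (fun z => u z * g z) = dotL2 f g.
Proof.
move=> iu Lf Lg; have bu := inner_ae_bounded iu.
rewrite dotL2Ml; apply: dotL2_ae_eq => //.
- by apply: L2M; [exact: ae_boundedJ | exact: L2M].
- exact: ae_eq_refl.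
apply: filterS (inner_mulJ iu) => z uz _.
by rewrite mulrA [_ * u z]mulrC uz mul1r.
Qed.

Lemma model_space_H2 u f : model_space u f -> H2 f.
Proof. by case. Qed.

Lemma model_space_L2 u f : model_space u f -> L2 f.
Proof. by move=> /model_space_H2 /H2_L2. Qed.

Lemma model_space_orth u f h : model_space u f -> H2 h ->
  dotL2 f (fun z => u z * h z) = 0.
Proof. by move=> [_]; apply. Qed.

Lemma model_space_orth_l u f h : inner_function u -> model_space u f -> H2 h ->
  dotL2 (fun z => u z * h z) f = 0.
Proof.
move=> iu Kf Hh; rewrite (dotL2J (model_space_L2 Kf)) ?model_space_orth //.
  by rewrite rmorph0.
by apply: L2M; [exact: inner_ae_bounded | exact: H2_L2].
Qed.

Lemma model_spaceD u f g : inner_function u -> model_space u f ->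
  model_space u g -> model_space u (fun z => f z + g z).
Proof.
move=> iu Kf Kg; have [Lf Lg] := (model_space_L2 Kf, model_space_L2 Kg).
split; first exact: H2D (model_space_H2 Kf) (model_space_H2 Kg).
move=> h Hh; rewrite dotL2Dl // ?model_space_orth ?addr0 //.
by apply: L2M; [exact: inner_ae_bounded | exact: H2_L2].
Qed.

Lemma model_spaceZ u x f : inner_function u -> model_space u f ->
  model_space u (fun z => x * f z).
Proof.
move=> iu Kf; have Lf := model_space_L2 Kf.
split; first exact: H2Z (model_space_H2 Kf).
move=> h Hh; rewrite dotL2Zl // ?model_space_orth ?mulr0 //.
by apply: L2M; [exact: inner_ae_bounded | exact: H2_L2].
Qed.

Lemma model_spaceB u f g : inner_function u -> model_space u f ->
  model_space u g -> model_space u (fun z => f z - g z).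
Proof.
move=> iu Kf Kg; have := model_spaceD iu Kf (model_spaceZ (-1) iu Kg).
by under eq_fun do rewrite mulN1r.
Qed.

(** The hypothesis says that q is the projection of conj(u) p on H^2, so that u q
    is the projection of p on u H^2, since multiplication by u is an isometry. *)
Lemma model_space_sub u p q : inner_function u -> H2 p -> H2 q ->
  (forall k, fourier_coef (fun z => (u z)^* * p z) k = fourier_coef q k) ->
  model_space u (fun z => p z - u z * q z).
Proof.
move=> iu Hp Hq upq; have bu := inner_ae_bounded iu; have Hu := inner_H2 iu.
have [Lp Lq] := (H2_L2 Hp, H2_L2 Hq).
split; first by apply: H2B => //; exact: H2M.
move=> h Hh; have Lh := H2_L2 Hh.
have Luh : L2 (fun z => u z * h z) by exact: L2M.
have Lup : L2 (fun z => (u z)^* * p z) by apply: L2M => //; exact: ae_boundedJ.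
rewrite dotL2Bl //; last exact: L2M.
rewrite inner_isometry //.
have -> : dotL2 p (fun z => u z * h z) = dotL2 (fun z => (u z)^* * p z) h.
  by rewrite dotL2Ml; under [in RHS]eq_fun do rewrite conjCK.
rewrite -dotL2Bl //; apply: dotL2_H2_eq0 => //; first exact: L2B.
by move=> k; rewrite fourier_coefB // upq subrr.
Qed.

(** Take for q the projection of conj(u) f on H^2. *)
Lemma H2_decomposition u f : inner_function u -> H2 f ->
  exists p q, [/\ model_space u p, H2 q & f = fun z => p z + u z * q z].
Proof.
move=> iu Hf; have Lf := H2_L2 Hf.
have Luf : L2 (fun z => (u z)^* * f z).
  by apply: L2M => //; exact/ae_boundedJ/inner_ae_bounded.
have [q Hq [_ fq]] := riesz_projection Luf.
exists (fun z => f z - u z * q z), q; split=> //.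
- by apply: model_space_sub => // k; rewrite fq.
- by apply/funext => z; rewrite subrK.
Qed.

(** With p the projection of f on H^2, the remainder f - p only has Fourier
    coefficients of negative index, so its conjugate is in H^2. *)
Lemma L2_decomposition f : L2 f ->
  exists p q, [/\ H2 p, H2 q & f = fun z => p z + (q z)^*].
Proof.
move=> Lf; have [p Hp [_ pf]] := riesz_projection Lf; have Lp := H2_L2 Hp.
have Lfp := L2B Lf Lp.
exists p, (fun z => (f z - p z)^*); split=> //.
- split=> [|n n0]; first exact: L2J.
  rewrite fourier_coefJ // fourier_coefB //.
  by case: n n0 => // k _; rewrite NegzE opprK pf subrr rmorph0.
- by apply/funext => z; rewrite conjCK addrC subrK.
Qed.

Lemma dotL2_1 f : dotL2 f (fun=> 1) = value0 f.
Proof. by congr dotL2; apply/funext => z; rewrite expr0z. Qed.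

Lemma dotL2_cstr f x : L2 f -> dotL2 f (fun=> x) = x^* * value0 f.
Proof.
move=> Lf; rewrite -dotL2_1 -dotL2Zr //; last exact: L2_cst.
by rewrite mulr1.
Qed.

Lemma fourier_coef_cst x n : fourier_coef (fun _ : T => x) n = x * (n == 0)%:R.
Proof.
rewrite eq_sym -fourier_coef_zpow -fourier_coefZ; last exact: L2_zpow.
by under [in RHS]eq_fun do rewrite zpow0 mulr1.
Qed.

(** This is the mean value property (f g)(0) = f(0) g(0), where f g is merely
    integrable. It holds because conj(g) - conj(g(0)) is orthogonal to H^2. *)
Lemma dotL2_conj_H2 f g : H2 f -> H2 g ->
  dotL2 (fun z => (g z)^*) f = (value0 g)^* * (value0 f)^*.
Proof.
move=> Hf Hg; have [Lf Lg] := (H2_L2 Hf, H2_L2 Hg); have LJ := L2J Lg.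
have L1 := @L2_cst R (value0 g)^*.
have : dotL2 (fun z => (g z)^* - (value0 g)^*) f = 0.
  apply: dotL2_H2_eq0 => // [|k]; first exact: L2B.
  rewrite fourier_coefB // fourier_coefJ // fourier_coef_cst.
  case: k => [|k]; first by rewrite mulr1 subrr.
  by rewrite (proj2 Hg) // mulr0 subr0 rmorph0.
rewrite dotL2Bl // => /eqP; rewrite subr_eq0 => /eqP ->.
by rewrite (dotL2J Lf L1) dotL2_cstr // rmorphM /= conjCK.
Qed.

Lemma ae_bounded_k0 u : inner_function u -> ae_bounded (k0 u).
Proof.
move=> iu; apply: ae_boundedB; first exact: ae_bounded_cst.
by apply: ae_boundedM; [exact: ae_bounded_cst | exact: inner_ae_bounded].
Qed.

(** The constant conj(u(0)) is the projection of conj(u) on H^2. *)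
Lemma model_space_k0 u : inner_function u -> model_space u (k0 u).
Proof.
move=> iu; have Lu := H2_L2 (inner_H2 iu).
have -> : k0 u = fun z => 1 - u z * (value0 u)^*.
  by apply/funext => z; rewrite mulrC.
apply: model_space_sub => // [||k]; [exact: H2_cst | exact: H2_cst |].
under eq_fun do rewrite mulr1.
rewrite fourier_coefJ // fourier_coef_cst.
case: k => [|k]; first by rewrite mulr1.
by rewrite (proj2 (inner_H2 iu)) // mulr0 rmorph0.
Qed.

Lemma k0_reproducing u f : inner_function u -> model_space u f ->
  dotL2 f (k0 u) = value0 f.
Proof.
move=> iu Kf; have Lf := model_space_L2 Kf; have Lu := H2_L2 (inner_H2 iu).
rewrite dotL2Br //; [|exact: L2_cst|exact: L2Z].
rewrite dotL2Zr // dotL2_1.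
have -> : dotL2 f u = dotL2 f (fun z => u z * 1).
  by under [in RHS]eq_fun do rewrite mulr1.
by rewrite model_space_orth ?mulr0 ?subr0 //; exact: H2_cst.
Qed.

(** If k0(0) = |k0|^2 vanishes then conj(u(0)) u = 1 almost everywhere, and u is
    constant. *)
Lemma value0_k0_neq0 u : inner_function u -> ~ constant_function u ->
  value0 (k0 u) != 0.
Proof.
move=> iu nc; apply/eqP => k00; apply: nc; exists (value0 u).
have Kk := model_space_k0 iu.
have := dotL2_eq0 (model_space_L2 Kk); rewrite k0_reproducing // => /(_ k00) k0ae.
have u0 : {ae m, forall z, 1 = (value0 u)^* * u z}.
  by apply: filterS k0ae => z /(_ I) /= /eqP; rewrite subr_eq0 => /eqP.
have v1 : value0 u * (value0 u)^* = 1.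
  have Lu := H2_L2 (inner_H2 iu).
  have : value0 (k0 u) = 1 - (value0 u)^* * value0 u.
    rewrite /value0 fourier_coefB; [|exact: L2_cst|exact: L2Z].
    by rewrite fourier_coefZ // fourier_coef_cst mulr1.
  by rewrite k00 => /esym/eqP; rewrite subr_eq0 mulrC => /eqP.
apply: filterS u0 => w uw _ /=.
by rewrite -[RHS]mulr1 uw mulrA v1 mul1r.
Qed.

(** It lowers the index of every Fourier
    coefficient of f by one and drops the constant term. *)
Definition backward_shift f : T -> C := fun z => zpow (- 1) z * (f z - value0 f).

Lemma ae_bounded_backward_shift f : ae_bounded f -> ae_bounded (backward_shift f).
Proof.
move=> bf; apply: ae_boundedM; first exact: ae_bounded_zpow.
by apply: ae_boundedB => //; exact: ae_bounded_cst.
Qed.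

Lemma model_space_backward_shift u f : inner_function u -> model_space u f ->
  model_space u (backward_shift f).
Proof.
move=> iu Kf; have Lf := model_space_L2 Kf; have L0 := @L2_cst R (value0 f).
have Lb : L2 (backward_shift f) by apply: L2M; [exact: ae_bounded_zpow | exact: L2B].
split.
  split=> // n n0; rewrite fourier_coefM_zpow opprK fourier_coefB //.
  rewrite fourier_coef_cst.
  have : n + 1 <= 0 by rewrite lezD1.
  rewrite le_eqVlt => /predU1P[->|n1]; first by rewrite mulr1 subrr.
  by rewrite (proj2 (model_space_H2 Kf)) // lt_eqF // mulr0 subrr.
move=> h Hh; have Lh := H2_L2 Hh; have Hu := inner_H2 iu.
have bu := inner_ae_bounded iu.
have Hzh : H2 (fun z => zpow 1 z * h z).
  by apply: H2M => //; [exact: ae_bounded_zpow | exact: (H2_zpow R 1)].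
have Hzuh : H2 (fun z => u z * (zpow 1 z * h z)) by exact: H2M.
rewrite dotL2Ml.
have -> : (fun z => (zpow (- 1) z)^* * (u \* h) z) =
          (fun z => u z * (zpow 1 z * h z)).
  by apply/funext => z; rewrite zpowJ opprK /= mulrCA.
rewrite dotL2Bl //; last exact: H2_L2.
rewrite model_space_orth // (dotL2J (H2_L2 Hzuh) L0) dotL2_cstr; last exact: H2_L2.
suff -> : value0 (fun z => u z * (zpow 1 z * h z)) = 0.
  by rewrite mulr0 rmorph0 subrr.
have -> : (fun z => u z * (zpow 1 z * h z)) = fun z => zpow 1 z * (u z * h z).
  by apply/funext => z; rewrite mulrCA.
by rewrite /value0 fourier_coefM_zpow (proj2 (H2M bu Hu Hh)).
Qed.

Lemma normL2_pythagoras f g : L2 f -> L2 g -> dotL2 f g = 0 ->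
  normL2 (fun z => f z - g z) ^+ 2 = normL2 f ^+ 2 + normL2 g ^+ 2.
Proof.
move=> Lf Lg fg; apply: realC_inj.
rewrite rmorphD /= -!dotL2_norm dotL2Bl ?dotL2Br //; try exact: L2B.
by rewrite (dotL2J Lf Lg) fg rmorph0; ring.
Qed.

(** Approximate f by a polynomial p of degree < N and project p on the model
    space. The projection of conj(u) p on H^2 is again a polynomial of degree < N,
    because conj(u) has no Fourier coefficient of positive index; so the projected
    function p - u q is bounded. Projecting does not increase the distance to f. *)
Lemma bounded_dense u f (e : R) : inner_function u -> model_space u f -> 0 < e ->
  exists g, [/\ model_space u g, ae_bounded g &
                normL2 (fun z => f z - g z) <= e].
Proof.
move=> iu Kf e0; have Hf := model_space_H2 Kf; have Lf := H2_L2 Hf.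
have Hu := inner_H2 iu; have bu := inner_ae_bounded iu.
have [N /(_ N (leqnn N)) fN] := H2_taylor_sum_lim Hf e0.
pose p := taylor_sum (fun k => fourier_coef f k) N.
pose q := taylor_sum (fun k => fourier_coef (fun z => (u z)^* * p z) k) N.
have Hp : H2 p by exact: H2_taylor_sum.
have Hq : H2 q by exact: H2_taylor_sum.
have [Lp Lq] := (H2_L2 Hp, H2_L2 Hq).
have Kg : model_space u (fun z => p z - u z * q z).
  apply: (model_space_sub iu Hp Hq) => k.
  rewrite fourier_coef_taylor_sum; case: ltnP => // Nk.
  have Luz : L2 (fun z => u z * zpow k z) by apply: L2M => //; exact: L2_zpow.
  rewrite fourier_coefE dotL2Ml.
  have -> : (fun z => ((u z)^*)^* * zpow k z) = fun z => u z * zpow k z.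
    by apply/funext => z; rewrite conjCK.
  rewrite (dotL2J Luz Lp) dotL2_taylor_sumr // big1 ?rmorph0 // => j _.
  have -> : (fun z => u z * zpow k z) = fun z => zpow k z * u z.
    by apply/funext => z; rewrite mulrC.
  rewrite fourier_coefM_zpow (proj2 Hu) ?mulr0 // subr_lt0 ltz_nat.
  exact: leq_trans (ltn_ord j) Nk.
exists (fun z => p z - u z * q z); split=> //.
  by apply: ae_boundedB; [|apply: ae_boundedM => //]; exact: ae_bounded_taylor_sum.
have Kfg := model_spaceB iu Kf Kg.
have Luq : L2 (fun z => u z * q z) by exact: L2M.
have := normL2_pythagoras (model_space_L2 Kfg) Luq
  (model_space_orth Kfg Hq).
have -> : (fun z => f z - (p z - u z * q z) - u z * q z) = fun z => f z - p z.
  by apply/funext => z; ring.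
move=> eq; apply: le_trans fN.
rewrite -(@ler_pXn2r _ 2) ?nnegrE ?normL2_ge0 // eq.
by rewrite lerDl sqr_ge0.
Qed.

Lemma bounded_orth_model u f : inner_function u -> L2 f ->
  (forall g, model_space u g -> ae_bounded g -> dotL2 f g = 0) ->
  forall g, model_space u g -> dotL2 f g = 0.
Proof.
move=> iu Lf fb g Kg; apply: (@le_normc_eq0 _ _ (normL2 f)) => e e0.
have [h [Kh bh gh]] := bounded_dense iu Kg e0.
have [Lg Lh] := (model_space_L2 Kg, model_space_L2 Kh).
rewrite -[dotL2 f g]subr0 -(fb h) // -dotL2Br //.
apply: le_trans (cauchy_schwarz Lf (L2B Lg Lh)) _.
by rewrite ler_wpM2l ?normL2_ge0.
Qed.

End model_spaces.

(** * Asymmetric truncated Toeplitz operators *)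

Section toeplitz.
Variable R : realType.
Local Notation C := R[i].
Local Notation T := (circle R).
Local Notation m := (circle_measure R).
Implicit Types (f g k p q phi : T -> C) (x y : C).

Lemma L2Mr f g : ae_bounded g -> L2 f -> L2 (fun z => f z * g z).
Proof.
move=> bg Lf; have := L2M bg Lf.
by under eq_fun do rewrite mulrC.
Qed.

Lemma L2_symbol f g : L2 f -> L2 g -> L2 (symbol f g).
Proof. by move=> Lf Lg; apply: L2D => //; exact: L2J. Qed.

Variables theta alpha : T -> C.
Hypotheses (itheta : inner_function theta) (ialpha : inner_function alpha).

Lemma ATTO_form phi B f k : is_ATTO theta alpha phi B -> model_space theta f ->
  L2 (fun z => phi z * f z) -> model_space alpha k ->
  dotL2 (fun z => phi z * f z) k = dotL2 (B f) k.
Proof.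
move=> [_ Bphi] Kf Lpf Kk; have [KB /(_ k Kk) /eqP] := Bphi f Kf Lpf.
rewrite dotL2Bl //; [|exact: (model_space_L2 KB)|exact: (model_space_L2 Kk)].
by rewrite subr_eq0 => /eqP.
Qed.

Lemma bounded_operatorB B f g : bounded_operator (model_space theta)
    (model_space alpha) B -> model_space theta f -> model_space theta g ->
  B (fun z => f z - g z) = (fun z => B f z - B g z) %[ae m].
Proof.
move=> [_ _ linB _] Kf Kg; have := linB (-1) g f Kg Kf.
have -> : (fun z => -1 * g z + f z) = fun z => f z - g z.
  by apply/funext => z; ring.
by apply: filterS => z /(_ I) Bz _; rewrite Bz //=; ring.
Qed.

(** The domain of the operator with symbol sigma is not that of the operator with
    symbol phi, so the two can be compared on bounded functions only. For bounded k
    both <B f, k> and <sigma f, k> = <f, conj(sigma) k> are continuous in f, and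
    they agree on the dense set of bounded f. When sigma f is square integrable,
    both are also continuous in k. *)
Lemma is_ATTO_of_bounded_form phi sigma B : L2 phi -> L2 sigma ->
  is_ATTO theta alpha phi B ->
  (forall f k, model_space theta f -> ae_bounded f ->
     model_space alpha k -> ae_bounded k ->
     dotL2 (fun z => sigma z * f z) k = dotL2 (fun z => phi z * f z) k) ->
  is_ATTO theta alpha sigma B.
Proof.
move=> Lphi Lsigma AB formE; have [bB _] := AB; split=> // f Kf Lsf.
have [KB aeB linB [M BM]] := bB.
have KBf := KB f Kf; split=> //.
have LBf := model_space_L2 KBf.
apply: bounded_orth_model => // [|k Kk bk]; first exact: L2B.
have Lk := model_space_L2 Kk.
rewrite dotL2Bl //; pose g z := (sigma z)^* * k z.
have Lg : L2 g by apply: L2Mr => //; exact: L2J.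
rewrite dotL2Ml -/g.
(* The operator bound M is not known to be nonnegative, whence its modulus. *)
apply: (@le_normc_eq0 _ _ (normL2 g + `|M| * normL2 k)) => e e0.
have [h [Kh bh fh]] := bounded_dense itheta Kf e0.
pose d z := f z - h z; have Kd : model_space theta d by exact: model_spaceB.
have [Lf Lh Ld] := And3 (model_space_L2 Kf) (model_space_L2 Kh)
  (model_space_L2 Kd).
have LBh := model_space_L2 (KB _ Kh); have LBd := model_space_L2 (KB _ Kd).
have hE : dotL2 h g = dotL2 (B h) k.
  rewrite /g -dotL2Ml formE //; apply: ATTO_form => //; exact: L2Mr.
have -> : dotL2 f g - dotL2 (B f) k = dotL2 d g - dotL2 (B d) k.
  rewrite (dotL2_ae_eq LBd (L2B LBf LBh) Lk Lk (bounded_operatorB bB Kf Kh)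
    (ae_eq_refl _ _ _)) /d !dotL2Bl // hE; ring.
apply: le_trans (le_normcD _ _) _; rewrite normcN mulrDl; apply: lerD.
  apply: le_trans (cauchy_schwarz Ld Lg) _.
  by rewrite mulrC ler_wpM2l ?normL2_ge0.
apply: le_trans (cauchy_schwarz LBd Lk) _.
rewrite mulrAC; apply: ler_pM; rewrite ?normL2_ge0 //.
apply: le_trans (BM _ Kd) _; apply: (@le_trans _ _ (`|M| * normL2 d)).
  by rewrite ler_wpM2r ?normL2_ge0 // ler_norm.
exact: ler_wpM2l.
Qed.

(** The terms alpha h1 and conj(theta h2) of phi act as zero on bounded functions:
    alpha f h1 is orthogonal to k, and f is orthogonal to theta k h2. *)
Lemma ATTO_symbol_exists phi B : L2 phi -> is_ATTO theta alpha phi B ->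
  exists psi chi, [/\ model_space alpha psi, model_space theta chi &
    is_ATTO theta alpha (symbol psi chi) B].
Proof.
move=> Lphi AB.
have [p [q [Hp Hq phiE]]] := L2_decomposition Lphi.
have [psi [h1 [Kpsi Hh1 pE]]] := H2_decomposition ialpha Hp.
have [chi [h2 [Kchi Hh2 qE]]] := H2_decomposition itheta Hq.
exists psi, chi; split=> //.
have Ls : L2 (symbol psi chi).
  by apply: L2_symbol; [exact: model_space_L2 Kpsi | exact: model_space_L2 Kchi].
apply: (is_ATTO_of_bounded_form Lphi Ls AB) => f k Kf bf Kk bk.
have [Hf Hk] := (model_space_H2 Kf, model_space_H2 Kk).
have [Lf Lk] := (H2_L2 Hf, H2_L2 Hk).
have [ba bt] := (inner_ae_bounded ialpha, inner_ae_bounded itheta).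
have Hfh1 : H2 (fun z => f z * h1 z) by exact: H2M.
have Hkh2 : H2 (fun z => k z * h2 z) by exact: H2M.
have -> : (fun z => phi z * f z) = fun z => symbol psi chi z * f z +
   (alpha z * (f z * h1 z) + (theta z * h2 z)^* * f z).
  apply/funext => z; rewrite phiE pE qE /symbol rmorphD /=; ring.
have L1 : L2 (fun z => symbol psi chi z * f z) by exact: L2Mr.
have Lah : L2 (fun z => alpha z * (f z * h1 z)) by apply: L2M => //; exact: H2_L2.
have L3 : L2 (fun z => (theta z * h2 z)^* * f z).
  by apply: L2Mr => //; apply/L2J/L2M => //; exact: H2_L2.
rewrite !dotL2Dl //; last exact: L2D.
rewrite (model_space_orth_l ialpha Kk Hfh1) add0r.
rewrite (dotL2Ml (fun z => (theta z * h2 z)^*)).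
have -> : (fun z => ((theta z * h2 z)^*)^* * k z) =
          fun z => theta z * (k z * h2 z).
  by apply/funext => z; rewrite conjCK; ring.
by rewrite (model_space_orth Kf Hkh2) addr0.
Qed.

(** Since |z| = 1, the integrand of the form at the backward shifts of f and k is
    w (f - f(0)) conj(k - k(0)), with w = psi + conj(chi). Expanding it and using
    that the form vanishes at (f, k) leaves the integrals of w f, w conj(k) and w,
    where the mean value property cancels all but two terms. *)
Lemma shift_identity psi chi f k : H2 psi -> H2 chi ->
  model_space theta f -> ae_bounded f -> model_space alpha k ->
  (forall f k, model_space theta f -> ae_bounded f -> model_space alpha k ->
     dotL2 (fun z => symbol psi chi z * f z) k = 0) ->
  (value0 k)^* * dotL2 f chi + value0 f * dotL2 psi k = 0.
Proof.
move=> Hpsi Hchi Kf bf Kk form0.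
have [Hf Hk] := (model_space_H2 Kf, model_space_H2 Kk).
have [Lf Lk] := (H2_L2 Hf, H2_L2 Hk).
have [Lpsi Lchi] := (H2_L2 Hpsi, H2_L2 Hchi).
have LJchi := L2J Lchi; have L1 := @L2_cst R 1.
set w := symbol psi chi; have Lw : L2 w by exact: L2_symbol.
have Lwf : L2 (fun z => w z * f z) by exact: L2Mr.
have Lwf0 : L2 (fun z => value0 f * w z) by exact: L2Z.
have Lk0 := @L2_cst R (value0 k).
have := form0 _ _ (model_space_backward_shift itheta Kf) (ae_bounded_backward_shift bf)
  (model_space_backward_shift ialpha Kk).
have -> : dotL2 (fun z => w z * backward_shift f z) (backward_shift k) =
    dotL2 (fun z => w z * f z - value0 f * w z) (fun z => k z - value0 k).
  rewrite /dotL2; congr cintegral; apply/funext => z.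
  rewrite /backward_shift rmorphM /= zpowJ opprK.
  transitivity ((zpow (- 1) z * zpow 1 z) *
     ((w z * f z - value0 f * w z) * (k z - value0 k)^*)); first by ring.
  by rewrite -zpowD addNr zpow0 mul1r.
rewrite dotL2Bl ?dotL2Br //; try exact: L2B.
rewrite form0 // !dotL2Zl // !dotL2_cstr //.
have -> : value0 (fun z => w z * f z) = value0 f * value0 psi + dotL2 f chi.
  rewrite -dotL2_1.
  have -> : (fun z => w z * f z) = fun z => psi z * f z + (chi z)^* * f z.
    by apply/funext => z; rewrite -mulrDl.
  rewrite dotL2Dl //; [|exact: L2Mr|exact: L2Mr].
  rewrite !dotL2Ml.
  have -> : dotL2 f (fun z => ((chi z)^*)^* * 1) = dotL2 f chi.
    by congr dotL2; apply/funext => z; rewrite conjCK mulr1.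
  have -> : dotL2 f (fun z => (psi z)^* * 1) = dotL2 f (fun z => (psi z)^*).
    by congr dotL2; apply/funext => z; rewrite mulr1.
  rewrite (dotL2J (L2J Lpsi) Lf) dotL2_conj_H2 // rmorphM /= !conjCK; ring.
have -> : dotL2 w k = dotL2 psi k + (value0 chi)^* * (value0 k)^*.
  by rewrite dotL2Dl // dotL2_conj_H2.
have -> : value0 w = value0 psi + (value0 chi)^*.
  by rewrite /value0 fourier_coefD // fourier_coefJ // oppr0.
move=> e; rewrite -[RHS]oppr0 -e; ring.
Qed.

(** The choice f = k0 theta in [shift_identity] determines psi, and then the choice
    k = k0 alpha determines the inner products of chi with bounded functions. The
    constants k0(0) = |k0|^2 by which one divides are nonzero because the inner
    functions are not constant. *)
Lemma ATTO_zero_symbol psi chi :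
  ~ constant_function theta -> ~ constant_function alpha ->
  model_space alpha psi -> model_space theta chi ->
  (forall f k, model_space theta f -> ae_bounded f -> model_space alpha k ->
     dotL2 (fun z => symbol psi chi z * f z) k = 0) ->
  exists c : C, psi = (fun z => c * k0 alpha z) %[ae m] /\
    chi = (fun z => - c^* * k0 theta z) %[ae m].
Proof.
move=> nctheta ncalpha Kpsi Kchi form0.
have [Hpsi Hchi] := (model_space_H2 Kpsi, model_space_H2 Kchi).
have [Lpsi Lchi] := (H2_L2 Hpsi, H2_L2 Hchi).
have ident f k Kf bf Kk := @shift_identity psi chi f k Hpsi Hchi Kf bf Kk form0.
have [Kt Ka] := (model_space_k0 itheta, model_space_k0 ialpha).
have bt := ae_bounded_k0 itheta.
have rept f (Kf : model_space theta f) := k0_reproducing itheta Kf.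
have repa f (Kf : model_space alpha f) := k0_reproducing ialpha Kf.
have t0 := value0_k0_neq0 itheta nctheta.
have a0 := value0_k0_neq0 ialpha ncalpha.
move: (k0 theta) (k0 alpha) Kt Ka bt rept repa t0 a0.
move=> kt ka Kt Ka bt rept repa t0 a0.
have [Lt La] := (model_space_L2 Kt, model_space_L2 Ka).
pose c := - (dotL2 kt chi / value0 kt).
have psiE k : model_space alpha k -> dotL2 psi k = c * (value0 k)^*.
  move=> Kk; have := ident _ _ Kt bt Kk.
  move=> /eqP; rewrite addrC addr_eq0 => /eqP e.
  by apply: (mulfI t0); rewrite e /c; field.
have a0r : (value0 ka)^* = value0 ka.
  by rewrite -(repa _ Ka) dotL2_norm conjcR.
exists c; split.
  have Kd : model_space alpha (fun z => psi z - c * ka z).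
    exact: model_spaceB ialpha Kpsi (model_spaceZ c ialpha Ka).
  have Ld := model_space_L2 Kd.
  have : dotL2 (fun z => psi z - c * ka z) (fun z => psi z - c * ka z) = 0.
    rewrite dotL2Bl ?dotL2Zl //; last exact: L2Z.
    by rewrite psiE // (dotL2J Ld La) repa // subrr.
  move=> /(dotL2_eq0 Ld); apply: filterS => z /(_ I) /eqP.
  by rewrite subr_eq0 => /eqP.
have chiE f : model_space theta f -> ae_bounded f ->
    dotL2 f chi = - c * value0 f.
  move=> Kf bf; have := ident _ _ Kf bf Ka; rewrite psiE // a0r.
  move=> /eqP; rewrite addr_eq0 => /eqP e.
  by apply: (mulfI a0); rewrite e; ring.
pose d z := chi z - (- c^*) * kt z.
have Kd : model_space theta d.
  exact: model_spaceB itheta Kchi (model_spaceZ _ itheta Kt).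
have Ld := model_space_L2 Kd.
have d0 f : model_space theta f -> ae_bounded f -> dotL2 d f = 0.
  move=> Kf bf; have Lf := model_space_L2 Kf.
  rewrite (dotL2J Lf Ld) dotL2Br ?dotL2Zr //; last exact: L2Z.
  by rewrite chiE // rept // rmorphN /= conjCK subrr rmorph0.
have := bounded_orth_model itheta Ld d0 Kd.
move=> /(dotL2_eq0 Ld); apply: filterS => z /(_ I) /eqP.
by rewrite subr_eq0 => /eqP.
Qed.

(** The symbols k0 alpha and conj(k0 theta) both define the operator that
    projects f on the model space of alpha: alpha f is orthogonal to k and f is
    orthogonal to theta k. So their difference is a symbol of the zero operator. *)
Lemma ATTO_k0_form f k : model_space theta f -> model_space alpha k ->
  dotL2 (fun z => k0 alpha z * f z) k = dotL2 (fun z => (k0 theta z)^* * f z) k.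
Proof.
move=> Kf Kk; have [Hf Hk] := (model_space_H2 Kf, model_space_H2 Kk).
have [Lf Lk] := (H2_L2 Hf, H2_L2 Hk).
have [ba bt] := (inner_ae_bounded ialpha, inner_ae_bounded itheta).
have Laf : L2 (fun z => alpha z * f z) by exact: L2M.
have Ltk : L2 (fun z => theta z * k z) by exact: L2M.
transitivity (dotL2 f k).
  have -> : (fun z => k0 alpha z * f z) =
      fun z => f z - (value0 alpha)^* * (alpha z * f z).
    by apply/funext => z; rewrite /k0; ring.
  rewrite dotL2Bl ?dotL2Zl //; last exact: L2Z.
  by rewrite (model_space_orth_l ialpha Kk Hf) mulr0 subr0.
rewrite dotL2Ml.
have -> : (fun z => ((k0 theta z)^*)^* * k z) =
    fun z => k z - (value0 theta)^* * (theta z * k z).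
  by apply/funext => z; rewrite conjCK /k0; ring.
rewrite dotL2Br ?dotL2Zr //; last exact: L2Z.
by rewrite (model_space_orth Kf Hk) mulr0 subr0.
Qed.

End toeplitz.

Theorem corollary4p5 (R : realType) (alpha theta phi : circle R -> R[i]) :
  inner_function alpha -> ~ constant_function alpha ->
  inner_function theta -> ~ constant_function theta ->
  inner_divides alpha theta ->
  L2 phi -> in_ATTO theta alpha phi ->
  (exists psi chi : circle R -> R[i],
    [/\ model_space alpha psi, model_space theta chi &
        same_ATTO theta alpha phi (symbol psi chi)]) /\
  (forall psi chi : circle R -> R[i],
    model_space alpha psi -> model_space theta chi ->
    same_ATTO theta alpha phi (symbol psi chi) ->
    forall psi1 chi1 : circle R -> R[i],
    model_space alpha psi1 -> model_space theta chi1 ->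
    (same_ATTO theta alpha (symbol psi chi) (symbol psi1 chi1) <->
     exists c : R[i],
       psi1 = (fun z => psi z + c * k0 alpha z) %[ae circle_measure R] /\
       chi1 = (fun z => chi z - c^* * k0 theta z) %[ae circle_measure R])).
Proof.
move=> ialpha ncalpha itheta nctheta _ Lphi [B AB]; split.
  have [psi [chi [Kpsi Kchi As]]] := ATTO_symbol_exists itheta ialpha Lphi AB.
  by exists psi, chi; split=> //; exists B.
move=> psi chi Kpsi Kchi [B0 [_ AB0]] psi1 chi1 Kpsi1 Kchi1.
have [Lpsi Lchi] := (model_space_L2 Kpsi, model_space_L2 Kchi).
have [Lpsi1 Lchi1] := (model_space_L2 Kpsi1, model_space_L2 Kchi1).
have Ls : L2 (symbol psi chi) by exact: L2_symbol.
have Ls1 : L2 (symbol psi1 chi1) by exact: L2_symbol.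
split=> [[B1 [A A1]]|[c [psiE chiE]]].
  have Kpsi2 := model_spaceB ialpha Kpsi1 Kpsi.
  have Kchi2 := model_spaceB itheta Kchi1 Kchi.
  have [f k Kf bf Kk|c [psiE chiE]] :=
      ATTO_zero_symbol itheta ialpha nctheta ncalpha Kpsi2 Kchi2.
    have -> : (fun z => symbol (fun z => psi1 z - psi z)
        (fun z => chi1 z - chi z) z * f z) =
        fun z => symbol psi1 chi1 z * f z - symbol psi chi z * f z.
      by apply/funext => z; rewrite /symbol rmorphB /=; ring.
    have Lsf : L2 (fun z => symbol psi chi z * f z) by exact: L2Mr.
    have Ls1f : L2 (fun z => symbol psi1 chi1 z * f z) by exact: L2Mr.
    rewrite dotL2Bl //; last exact: model_space_L2 Kk.
    by rewrite (ATTO_form A) // (ATTO_form A1) // subrr.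
  exists c; split.
  - apply: filterS psiE => z /(_ I) e _; rewrite -e; ring.
  - apply: filterS chiE => z /(_ I) e _; rewrite -mulNr -e; ring.
exists B0; split=> //.
apply: (is_ATTO_of_bounded_form itheta ialpha Ls Ls1 AB0) => f k Kf bf Kk bk.
have [Lf Lk] := (model_space_L2 Kf, model_space_L2 Kk).
have Lsf : L2 (fun z => symbol psi chi z * f z) by exact: L2Mr.
have Lka : L2 (fun z => k0 alpha z * f z).
  by apply: L2M => //; exact: ae_bounded_k0.
have Lkt : L2 (fun z => (k0 theta z)^* * f z).
  by apply: L2M => //; exact/ae_boundedJ/ae_bounded_k0.
have LD := L2B Lka Lkt.
transitivity (dotL2 (fun z => symbol psi chi z * f z +
    c * (k0 alpha z * f z - (k0 theta z)^* * f z)) k).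
  apply: dotL2_ae_eq => //; [exact: L2Mr | by apply: L2D => //; exact: L2Z | |
    exact: ae_eq_refl].
  apply: filterS2 psiE chiE => z /(_ I) e1 /(_ I) e2 _.
  rewrite /symbol e1 e2 rmorphB rmorphM /= conjCK; ring.
rewrite dotL2Dl ?dotL2Zl //; last exact: L2Z.
by rewrite dotL2Bl // (ATTO_k0_form itheta ialpha Kf Kk) subrr mulr0 addr0.
Qed.
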